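(* Let $\Bbbk=\mathbb{Q}$ or $\Bbbk=\mathbb{Z}/p\mathbb{Z}$ ($p$ a prime), $S=\Bbbk[x_1,\ldots,x_n]$, let $f\in S$ and let $\prec$ be a term order on $S$ such that the initial monomial $\mathrm{in}_{\prec} f$ is a square-free monomial. Then for every proper ideal $I\in\mathcal{C}_f$, $$\operatorname{diam}(I)\leq\operatorname{diam}(\mathrm{in}_{\prec} I).$$
   Context: For $f\in S$, $\mathcal{C}_f$ denotes the smallest set of ideals of $S$ satisfying: (1) $(f)\in\mathcal{C}_f$; (2) if $I\in\mathcal{C}_f$, then $I:J\in\mathcal{C}_f$ for any ideal $J\subseteq S$; (3) if $I,J\in\mathcal{C}_f$, then $I+J\in\mathcal{C}_f$ and $I\cap J\in\mathcal{C}_f$. Ideals are not assumed homogeneous. $\mathrm{in}_\prec I$ is the initial ideal of $I$, generated by the initial monomials of the nonzero elements of $I$. For a proper ideal $J\subset S$ with minimal primes $\mathfrak{q}_1,\ldots,\mathfrak{q}_t$, the dual graph $G(J)$ is the simple graph with vertex set $\{1,\ldots,t\}$ in which $\{i,j\}$ (with $i\ne j$) is an edge if and only if $\operatorname{height}(\mathfrak{q}_i+\mathfrak{q}_j)=\operatorname{height}(J)+1$ (the unit ideal is regarded as having height $\infty$). The diameter $\operatorname{diam}(J)$ is the diameter of the graph $G(J)$: the maximum over pairs of vertices of their distance, where the distance of two vertices is the minimum number of edges in a path connecting them ($0$ if they are equal, $\infty$ if no path connects them). The diameter may be $\infty$, and the inequality is in $\mathbb{N}\cup\{\infty\}$. 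*)

(* Defs.v *)
From HB Require Import structures.
From mathcomp Require Import all_boot all_order all_algebra.
From mathcomp Require Import boolp classical_sets.
From mathcomp Require Import mpoly.

Set Implicit Arguments.
Unset Strict Implicit.
Unset Printing Implicit Defensive.

Import Order.TTheory GRing.Theory.

Local Open Scope classical_set_scope.
Local Open Scope ring_scope.

(* The extended natural numbers: [Some k] is the number k, [None] is infinity. *)
Definition enat : Type := option nat.

HB.instance Definition _ := Choice.on enat.

Definition le_enat (x y : enat) : bool :=
  match y, x with
  | None, _ => true
  | Some _, None => false
  | Some b, Some a => (a <= b)%N
  end.

Fact le_enat_refl : reflexive le_enat.
Proof. by case=> [a|] //=; exact: leqnn. Qed.

Fact le_enat_anti : antisymmetric le_enat.
Proof. by case=> [a|] [b|] //= h; congr Some; apply/eqP; rewrite eqn_leq. Qed.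

Fact le_enat_trans : transitive le_enat.
Proof. by case=> [b|] [a|] [c|] //=; exact: leq_trans. Qed.

Fact enat_display : Order.disp_t.
Proof. exact: Order.Disp tt tt. Qed.

HB.instance Definition _ := Order.Le_isPOrder.Build enat_display enat
  le_enat_refl le_enat_anti le_enat_trans.

Lemma enat_supremums_neq0 (A : set enat) : supremums A !=set0.
Proof.
case: (pselect (ubound A None /\ exists b, ubound A (Some b : enat))); last first.
  move=> nb; exists None; split=> [[a|] _ //|[b|] ub_b //].
  by case: nb; split; [move=> x _; case: x | exists b].
case=> _ [b ub_b].
have exP : exists k, `[< ubound A (Some k : enat) >] by exists b; apply/asboolP.
case: (ex_minnP exP) => k /asboolP ub_k min_k.
exists (Some k : enat); split=> // -[c|] ub_c //.
by apply: min_k; apply/asboolP.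
Qed.

Lemma enat_infimums_neq0 (A : set enat) : infimums A !=set0.
Proof.
case: (pselect (exists k, A (Some k : enat))) => [[k0 Ak0]|nA]; last first.
  exists None; split=> [[a|] Aa //|]; last by move=> x _; case: x.
  by case: nA; exists a.
have exP : exists k, `[< A (Some k : enat) >] by exists k0; apply/asboolP.
case: (ex_minnP exP) => k /asboolP Ak min_k.
exists (Some k : enat); split=> [[a|] Aa //|x lbx]; last exact: lbx.
by apply: min_k; apply/asboolP.
Qed.

Definition esup (A : set enat) : enat := supremum (Some 0%N : enat) A.
Definition einf (A : set enat) : enat := infimum (None : enat) A.
Definition esucc (x : enat) : enat := omap succn x.

(* Ideals of a commutative ring, as sets; the unit ideal [setT] is included. *)
Definition is_ideal (R : comNzRingType) (I : set R) : Prop :=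
  [/\ I 0, forall x y, I x -> I y -> I (x + y)
    & forall a x, I x -> I (a * x)].

Definition ideal_gen (R : comNzRingType) (G : set R) : set R :=
  smallest (@is_ideal R) G.

Definition ideal_add (R : comNzRingType) (I J : set R) : set R :=
  [set x + y | x in I & y in J].

Definition ideal_colon (R : comNzRingType) (I J : set R) : set R :=
  [set x | forall y, J y -> I (x * y)].

Definition prime_ideal (R : comNzRingType) (P : set R) : Prop :=
  [/\ is_ideal P, P <> setT & forall x y, P (x * y) -> P x \/ P y].

Definition minimal_prime (R : comNzRingType) (J P : set R) : Prop :=
  [/\ prime_ideal P, J `<=` P
    & forall Q, prime_ideal Q -> J `<=` Q -> Q `<=` P -> Q = P].

Definition prime_chain (R : comNzRingType) (P : set R) (k : nat) : Prop :=
  exists Q : nat -> set R,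
    [/\ forall i, (i <= k)%N -> prime_ideal (Q i),
        forall i, (i < k)%N -> Q i `<` Q i.+1
      & Q k = P].

Definition prime_height (R : comNzRingType) (P : set R) : enat :=
  esup [set (Some k : enat) | k in prime_chain P].

(* No prime contains the unit ideal, whose height is thus [einf set0 = None]. *)
Definition height (R : comNzRingType) (J : set R) : enat :=
  einf [set prime_height P | P in [set P | prime_ideal P /\ J `<=` P]].

(* [e] is the adjacency relation of a simple graph. *)
Definition graph_dist (T : eqType) (e : rel T) (x y : T) : enat :=
  einf [set (Some (size s) : enat) | s in
         [set s | [/\ path e x s, uniq (x :: s) & last x s = y]]].

Definition graph_diam (T : eqType) (V : set T) (e : rel T) : enat :=
  esup [set graph_dist e x y | x in V & y in V].

(* The vertices of the dual graph are the minimal primes themselves rather than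
   the indices of an enumeration of them. *)
Definition dual_adj (R : comNzRingType) (J : set R) : rel (set R) :=
  fun P Q => `[< [/\ minimal_prime J P, minimal_prime J Q, P <> Q
                   & height (ideal_add P Q) = esucc (height J)] >].

Definition diam (R : comNzRingType) (J : set R) : enat :=
  graph_diam (minimal_prime J) (dual_adj J).

Record term_order (n : nat) (le : rel 'X_{1..n}) : Prop := TermOrder {
  term_order_refl : reflexive le;
  term_order_anti : antisymmetric le;
  term_order_trans : transitive le;
  term_order_total : total le;
  term_order_ge0 : forall m, le 0%MM m;
  term_order_add : forall m m1 m2, le m1 m2 -> le (m + m1)%MM (m + m2)%MM
}.

(* No [m] satisfies this when [f = 0]. *)
Definition initial_monomial (n : nat) (K : fieldType) (le : rel 'X_{1..n})
    (f : {mpoly K[n]}) (m : 'X_{1..n}) : Prop :=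
  m \in msupp f /\ {in msupp f, forall m', le m' m}.

Definition squarefree_monomial (n : nat) (m : 'X_{1..n}) : Prop :=
  forall i : 'I_n, (m i <= 1)%N.

Definition initial_ideal (n : nat) (K : fieldType) (le : rel 'X_{1..n})
    (I : set {mpoly K[n]}) : set {mpoly K[n]} :=
  ideal_gen [set p | exists f m,
    [/\ I f, f != 0, initial_monomial le f m & p = 'X_[m]]].

(* The set of ideals C_f. *)
Inductive ideal_family (R : comNzRingType) (f : R) : set R -> Prop :=
| ideal_family_gen : ideal_family f (ideal_gen [set f])
| ideal_family_colon I J :
    ideal_family f I -> is_ideal J -> ideal_family f (ideal_colon I J)
| ideal_family_add I J :
    ideal_family f I -> ideal_family f J -> ideal_family f (ideal_add I J)
| ideal_family_cap I J :
    ideal_family f I -> ideal_family f J -> ideal_family f (I `&` J).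

(* Main.v *)
(* Extend f to F = f * r with initial monomial x_1 ... x_n.  Over F_p every ideal I of
   the family is stable under the Frobenius splitting g |-> Tr(F^(p-1) g), which sends an
   element with initial monomial x^(p b) to one with initial monomial x^b; hence in(I) is
   radical, and from in(I) in(J) <= in(I :&: J) one gets in(I :&: J) = in(I) :&: in(J) and
   in(I + J) = in(I) + in(J).  Over Q the same holds through reduction modulo p: stability
   is required for I :&: Z_(p)[x] modulo p at almost all p, and the operations of the
   family preserve it because an ideal with a Groebner basis that is p-integral with unit
   leading coefficients behaves well modulo p.

   Chains of ideals in the family are finite, since in(I) is one of finitely many
   square-free monomial ideals; so each I is a finite intersection of primes of the family.
   Moreover height(I) = height(in(I)): heights of primes are computed by sets of variables
   that are algebraically independent modulo the prime, and comparing
   Hilbert functions for a suitable weight shows that the maximal size of such a set is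
   the same modulo the initial ideal.

   Finally each minimal prime P of I has a minimal prime G of in(I) that contains in(P')
   for P' = P only, and each minimal prime of in(I) contains some in(P).  A path of
   G(in(I)) thus projects to a walk of G(I): for adjacent G, G' above in(P), in(P') with
   P <> P', the ideal P + P' has initial ideal in(P) + in(P') <= G + G', hence height
   at most height(I) + 1. *)

Require Import Defs.
From HB Require Import structures.
From mathcomp Require Import all_boot all_order all_algebra.
From mathcomp Require Import boolp classical_sets.
From mathcomp Require Import mpoly ring zify lra.

Set Implicit Arguments.
Unset Strict Implicit.
Unset Printing Implicit Defensive.

Import Order.TTheory GRing.Theory Num.Theory.

Local Open Scope classical_set_scope.
Local Open Scope ring_scope.

(** * Monomials and term orders *)

Section TermOrders.
Variable n : nat.
Implicit Types (a b m : 'X_{1..n}) (A : set 'X_{1..n}).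

Definition divisor_basis A (s : seq 'X_{1..n}) : Prop :=
  (forall m, m \in s -> A m) /\
  forall m, A m -> exists2 m', m' \in s & (m' <= m)%MM.

(** Induction on the number of coordinates outside [D], the only ones in which members of [A] may
    differ. Fix [a] in [A]: a member not divisible by x^a has some coordinate [i] below [a i], so it
    lies in one of finitely many slices, each constant on one more coordinate. *)
Lemma dickson_slice k (D : {set 'I_n}) A : (#|~: D| <= k)%N ->
  (forall a b, A a -> A b -> {in D, a =1 b}) -> exists s, divisor_basis A s.
Proof.
elim: k D A => [|k IHk] D A Dk Aconst.
  have DT i : i \in D.
    by move: Dk; rewrite leqn0 cards_eq0 => /eqP/setP/(_ i); rewrite !inE => /negbFE.
  case: (pselect (exists a, A a)) => [[a Aa]|nA]; last first.
    by exists [::]; split=> // m Am; case: nA; exists m.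
  exists [:: a]; split=> m; first by rewrite inE => /eqP->.
  move=> Am; exists a; rewrite ?mem_head //; apply/mnm_lepP => i.
  by rewrite (Aconst _ _ Aa Am).
case: (pselect (exists a, A a)) => [[a Aa]|nA]; last first.
  by exists [::]; split=> // m Am; case: nA; exists m.
pose sl (iv : 'I_n * nat) := [set b | A b /\ b iv.1 = iv.2].
have /choice[S HS] : forall iv, exists s, iv.1 \notin D -> divisor_basis (sl iv) s.
  case=> i v /=; case: (boolP (i \in D)) => [_|iD]; first by exists [::].
  have [|b c [Ab bv] [Ac cv] j|s Hs] := IHk (i |: D) (sl (i, v)); last by exists s.
  - move: Dk; rewrite (cardsD1 i) !inE iD /= add1n ltnS; apply: leq_trans.
    by apply: subset_leq_card; apply/fintype.subsetP => j; rewrite !inE negb_or.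
  - by rewrite !inE => /predU1P[->|jD]; [rewrite bv cv | apply: (Aconst _ _ Ab Ac)].
exists (a :: flatten [seq flatten [seq S (i, v) | v <- iota 0 (a i)]
                     | i <- [seq i <- enum 'I_n | i \notin D]]).
split=> m; rewrite ?inE.
  case/predU1P => [-> //|/flatten_mapP[i]]; rewrite mem_filter => /andP[iD _].
  by case/flatten_mapP => v _ /(proj1 (HS (i, v) iD))[].
move=> Am; case: (boolP (a <= m)%MM) => [am|]; first by exists a; rewrite ?mem_head.
move/mnm_lepP/existsNP => [i /negP]; rewrite -ltnNge => mi.
have iD : i \notin D.
  by apply: contraTN mi => iD; rewrite (Aconst _ _ Am Aa) // ltnn.
have [//|m' m's m'm] := proj2 (HS (i, m i) iD) m; exists m' => //.
rewrite inE; apply/orP; right; apply/flatten_mapP; exists i.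
  by rewrite mem_filter iD mem_enum.
by apply/flatten_mapP; exists (m i); rewrite // mem_iota.
Qed.

Lemma dickson A : exists s, divisor_basis A s.
Proof.
by apply: (dickson_slice (D := finset.set0) (leqnn _)) => a b _ _ i; rewrite inE.
Qed.

Variables (ord : rel 'X_{1..n}) (hord : term_order ord).

Definition tlt a b := ord a b && (a != b).

Lemma tord_refl a : ord a a. Proof. exact: term_order_refl hord a. Qed.

Lemma tord_trans b a c : ord a b -> ord b c -> ord a c.
Proof. exact: (term_order_trans hord). Qed.

Lemma tord_anti a b : ord a b -> ord b a -> a = b.
Proof. by move=> ab ba; apply: (term_order_anti hord); rewrite ab. Qed.

Lemma tord_div a b : (a <= b)%MM -> ord a b.
Proof.
move=> /submK <-; rewrite -{1}[a]add0m addmC [(_ + a)%MM]addmC.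
exact/(term_order_add hord)/(term_order_ge0 hord).
Qed.

Lemma tltW a b : tlt a b -> ord a b. Proof. by case/andP. Qed.

Lemma tord_nlt a b : ~~ tlt a b -> ord b a.
Proof.
rewrite /tlt; case/orP: (term_order_total hord a b) => //= ->.
by move/negPn/eqP->; exact: tord_refl.
Qed.

Lemma tord_lt_trans b a c : ord a b -> tlt b c -> tlt a c.
Proof.
move=> ab /andP[bc nbc]; rewrite /tlt (tord_trans ab bc).
by apply: contra nbc => /eqP ac; rewrite -ac in bc *; rewrite (tord_anti ab bc).
Qed.

Lemma tltxx a : tlt a a = false. Proof. by rewrite /tlt eqxx andbF. Qed.

Lemma tord_tltF a b : ord a b -> tlt b a = false.
Proof. by move=> ab; apply/negP => ba; have := tord_lt_trans ab ba; rewrite tltxx. Qed.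

Lemma tord_add a a' b b' : ord a a' -> ord b b' -> ord (a + b)%MM (a' + b')%MM.
Proof.
move=> aa bb; apply: (tord_trans (term_order_add hord a bb)).
by rewrite ![(_ + b')%MM]addmC; apply: term_order_add.
Qed.

Lemma tord_addI a b b' : ord (a + b)%MM (a + b')%MM -> ord b b'.
Proof.
move=> h; apply: tord_nlt; apply/negP => /andP[lt ne].
have /addmI e := tord_anti h (term_order_add hord a lt).
by rewrite e eqxx in ne.
Qed.

Lemma tlt_add a a' b b' : ord a a' -> tlt b b' -> tlt (a + b)%MM (a' + b')%MM.
Proof.
move=> aa /andP[bb nbb]; rewrite /tlt tord_add //; apply: contra nbb => /eqP e.
apply/eqP/tord_anti => //; apply: (@tord_addI a); rewrite e.
by rewrite ![(_ + b')%MM]addmC; apply: term_order_add.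
Qed.

Lemma tlt_muln k a b : (0 < k)%N -> tlt a b -> tlt (a *+ k)%MM (b *+ k)%MM.
Proof.
case: k => // k _ ab; elim: k => [|k IHk]; first by rewrite !mulm1n.
by rewrite mulmS [(b *+ _)%MM]mulmS; apply: tlt_add => //; apply: tltW.
Qed.

(** By Dickson's lemma the non-accessible monomials have a finite divisor basis. Its [ord]-least
    member is least among all of them, since divisibility implies [ord]; everything below it is thus
    accessible, a contradiction. *)
Lemma tlt_wf : well_founded tlt.
Proof.
move=> x; apply: contrapT => nx.
have [s [sA sB]] := dickson [set a | ~ Acc tlt a].
have [y ys _] := sB x nx.
have {ys} [z zs zmin] : exists2 z, z \in s & forall y, y \in s -> ord z y.
  elim: s {sA sB} y ys => // a s IHs y _; case: s IHs => [|b s] IHs.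
    by exists a => [|y']; rewrite ?mem_head // inE => /eqP->; apply: tord_refl.
  have [|z zs zmin] := IHs b; first exact: mem_head.
  case/orP: (term_order_total hord a z) => az.
    exists a => [|y' /predU1P[->|/zmin]]; [exact: mem_head|exact: tord_refl|].
    exact: tord_trans.
  by exists z => [|y' /predU1P[->|/zmin]] //; rewrite inE zs orbT.
apply: (sA z zs); constructor=> w wz; apply: contrapT => nw.
have [z' z's /tord_div z'w] := sB w nw.
by have := tord_lt_trans (tord_trans (zmin _ z's) z'w) wz; rewrite tltxx.
Qed.

End TermOrders.

(** * Ideals and initial monomials *)

Section Ideals.
Variable R : comNzRingType.
Implicit Types (I J P : set R) (x y : R).

Lemma ideal0 I : is_ideal I -> I 0. Proof. by case. Qed.
Lemma idealD I x y : is_ideal I -> I x -> I y -> I (x + y).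
Proof. by case=> _ + _; apply. Qed.
Lemma idealMl I a x : is_ideal I -> I x -> I (a * x).
Proof. by case=> _ _; apply. Qed.
Lemma idealMr I a x : is_ideal I -> I x -> I (x * a).
Proof. by rewrite mulrC; apply: idealMl. Qed.
Lemma idealN I x : is_ideal I -> I x -> I (- x).
Proof. by rewrite -mulN1r; apply: idealMl. Qed.
Lemma idealB I x y : is_ideal I -> I x -> I y -> I (x - y).
Proof. by move=> hI Ix Iy; apply: idealD => //; apply: idealN. Qed.
Lemma idealDr I x y : is_ideal I -> I y -> I (x + y) -> I x.
Proof. by move=> hI Iy Ixy; rewrite -(addrK y x); apply: idealB. Qed.
Lemma ideal_sum (T : Type) (r : seq T) (p : pred T) (F : T -> R) I :
  is_ideal I -> (forall i, p i -> I (F i)) -> I (\sum_(i <- r | p i) F i).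
Proof.
by move=> hI IF; elim/big_ind: _ => //; [apply: ideal0|move=> x y; apply: idealD].
Qed.

Lemma ideal_setT : is_ideal (setT : set R). Proof. by []. Qed.

Lemma ideal1 I : is_ideal I -> I 1 -> I = setT.
Proof.
by move=> hI I1; apply/seteqP; split=> // x _; rewrite -[x]mulr1; apply: idealMl.
Qed.

Lemma is_ideal_gen (G : set R) : is_ideal (ideal_gen G).
Proof.
split=> [J [hJ _]|x y Gx Gy J JG|a x Gx J JG].
- exact: ideal0.
- by apply: idealD; [case: JG|apply: Gx|apply: Gy].
- by apply: idealMl; [case: JG|apply: Gx].
Qed.

Lemma is_ideal_add I J : is_ideal I -> is_ideal J -> is_ideal (ideal_add I J).
Proof.
move=> hI hJ; split.
- by exists 0; [apply: ideal0|exists 0; [apply: ideal0|rewrite addr0]].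
- move=> _ _ [x Ix [y Jy <-]] [x' Ix' [y' Jy' <-]].
  by exists (x + x'); [apply: idealD|exists (y + y'); [apply: idealD|rewrite addrACA]].
- move=> a _ [x Ix [y Jy <-]].
  by exists (a * x); [apply: idealMl|exists (a * y); [apply: idealMl|rewrite mulrDr]].
Qed.

Lemma is_ideal_cap I J : is_ideal I -> is_ideal J -> is_ideal (I `&` J).
Proof.
move=> hI hJ; split=> [|x y [? ?] [? ?]|a x [? ?]]; split;
  by [apply: ideal0|apply: idealD|apply: idealMl].
Qed.

Lemma ideal_addl I J : is_ideal J -> I `<=` ideal_add I J.
Proof. by move=> hJ x Ix; exists x => //; exists 0; [apply: ideal0|rewrite addr0]. Qed.
Lemma ideal_addr I J : is_ideal I -> J `<=` ideal_add I J.
Proof. by move=> hI x Jx; exists 0; [apply: ideal0|exists x => //; rewrite add0r]. Qed.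

Lemma prime_is_ideal P : prime_ideal P -> is_ideal P. Proof. by case. Qed.
Lemma prime_not1 P : prime_ideal P -> ~ P 1.
Proof. by case=> hP PT _ P1; apply: PT; apply: ideal1. Qed.
Lemma primeM P x y : prime_ideal P -> P (x * y) -> P x \/ P y.
Proof. by case=> _ _; apply. Qed.
Lemma prime_prod P (T : eqType) (r : seq T) (F : T -> R) :
  prime_ideal P -> P (\prod_(i <- r) F i) -> exists2 i, i \in r & P (F i).
Proof.
move=> hP; elim: r => [|t r IHr]; first by rewrite big_nil => /(prime_not1 hP).
rewrite big_cons => /(primeM hP)[?|/IHr[i ir ?]]; [exists t|exists i] => //.
  exact: mem_head.
by rewrite inE ir orbT.
Qed.

End Ideals.

Section Leading.
Variables (n : nat) (K : fieldType) (ord : rel 'X_{1..n}).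
Hypothesis hord : term_order ord.
Local Notation S := {mpoly K[n]}.
Implicit Types (f g h p : S) (a b m : 'X_{1..n}) (c : K) (I J : set S).
Local Notation tlt := (tlt ord).
Local Notation lead := (initial_monomial ord).

(** Unlike [initial_monomial], these bounds survive sums and cancellation and hold of 0. *)
Definition ubnd f a := forall m, m \in msupp f -> ord m a.
Definition sbnd f a := forall m, m \in msupp f -> tlt m a.

Lemma lead_ubnd f a : lead f a -> ubnd f a. Proof. by case=> _ h m /h. Qed.
Lemma lead_coef_neq0 f a : lead f a -> f@_a != 0.
Proof. by case=> + _; rewrite mcoeff_msupp. Qed.
Lemma ubnd_lead f a : ubnd f a -> f@_a != 0 -> lead f a.
Proof. by move=> fa; rewrite -mcoeff_msupp => ?; split=> // m /fa. Qed.
Lemma lead_neq0 f a : lead f a -> f != 0.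
Proof. by move=> /lead_coef_neq0; apply: contraNneq => ->; rewrite mcoeff0. Qed.

Lemma lead_exists f : f != 0 -> exists a, lead f a.
Proof.
rewrite -msupp_eq0 /initial_monomial; elim: (msupp f) => // a s IHs _.
case: s IHs => [|b s] IHs.
  by exists a; split=> [|m]; rewrite ?mem_head // inE => /eqP->; apply: tord_refl.
have [//|z [zs zmax]] := IHs.
case/orP: (term_order_total hord z a) => az.
  exists a; split=> [|y' /predU1P[->|/zmax]]; [exact: mem_head|exact: tord_refl|].
  by move=> ?; apply: (tord_trans hord) az.
by exists z; split=> [|y' /predU1P[->|/zmax]] //; rewrite inE zs orbT.
Qed.

Lemma lead_uniq f a b : lead f a -> lead f b -> a = b.
Proof. by move=> [af fa] [bf fb]; apply: (tord_anti hord); [apply: fb|apply: fa]. Qed.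

Lemma sbnd_coef f a : sbnd f a -> f@_a = 0.
Proof. by move=> h; apply: memN_msupp_eq0; apply/negP => /h; rewrite tltxx. Qed.
Lemma ubnd_coef0 f a m : ubnd f a -> tlt a m -> f@_m = 0.
Proof.
by move=> h am; apply: memN_msupp_eq0; apply/negP => /h /(tord_tltF hord); rewrite am.
Qed.
Lemma ubndS f a b : ubnd f a -> ord a b -> ubnd f b.
Proof. by move=> fa ab m /fa ma; apply: (tord_trans hord) ab. Qed.
Lemma ubndD f g a : ubnd f a -> ubnd g a -> ubnd (f + g) a.
Proof. by move=> fa ga m /msuppD_le; rewrite mem_cat => /orP[/fa|/ga]. Qed.
Lemma ubndZ c f a : ubnd f a -> ubnd (c *: f) a.
Proof. by move=> fa m /msuppZ_le /fa. Qed.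
Lemma ubndN f a : ubnd f a -> ubnd (- f) a.
Proof. by move=> fa m; rewrite (perm_mem (msuppN f)) => /fa. Qed.
Lemma ubndB f g a : ubnd f a -> ubnd g a -> ubnd (f - g) a.
Proof. by move=> fa /ubndN; apply: ubndD. Qed.
Lemma ubndX a : ubnd 'X_[a] a.
Proof. by move=> m; rewrite msuppX inE => /eqP->; apply: tord_refl. Qed.

Lemma ubnd_sbnd f a : ubnd f a -> f@_a = 0 -> sbnd f a.
Proof.
move=> fa f0 m mf; apply/andP; split; first exact: fa.
by apply: contraTneq mf => ->; rewrite mcoeff_msupp f0 eqxx.
Qed.

Lemma lead_cancel f g a : ubnd f a -> ubnd g a -> f@_a = g@_a -> sbnd (f - g) a.
Proof. by move=> fa ga e; apply: ubnd_sbnd; [apply: ubndB|rewrite mcoeffB e subrr]. Qed.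

Lemma ubndM f g a b : ubnd f a -> ubnd g b -> ubnd (f * g) (a + b)%MM.
Proof.
move=> fa gb m /msuppM_le /allpairsP[[x y] /= [/fa xa /gb yb ->]].
exact: tord_add.
Qed.

Lemma sbndM f g a b : ubnd f a -> sbnd g b -> sbnd (f * g) (a + b)%MM.
Proof.
move=> fa gb m /msuppM_le /allpairsP[[x y] /= [/fa xa /gb yb ->]].
exact: tlt_add.
Qed.

(** Splitting off the terms at [a] and [b] leaves two products strictly below a + b. *)
Lemma lead_coefM f g a b : ubnd f a -> ubnd g b -> (f * g)@_(a + b) = f@_a * g@_b.
Proof.
move=> fa gb.
have f's : sbnd (f - f@_a *: 'X_[a]) a.
  by apply: lead_cancel => //; [apply/ubndZ/ubndX|rewrite mcoeffZ mcoeffX eqxx mulr1].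
have g's : sbnd (g - g@_b *: 'X_[b]) b.
  by apply: lead_cancel => //; [apply/ubndZ/ubndX|rewrite mcoeffZ mcoeffX eqxx mulr1].
have -> : f * g = (f - f@_a *: 'X_[a]) * g + f@_a *: 'X_[a] * (g - g@_b *: 'X_[b])
    + (f@_a * g@_b) *: 'X_[a + b].
  by rewrite mpolyXD -!mul_mpolyC rmorphM /=; ring.
rewrite !mcoeffD mcoeffZ mcoeffX eqxx mulr1 (sbnd_coef (sbndM (ubndZ (@ubndX a)) g's)).
by rewrite mulrC addmC (sbnd_coef (sbndM gb f's)) !add0r.
Qed.

Lemma leadM f g a b : lead f a -> lead g b -> lead (f * g) (a + b)%MM.
Proof.
move=> la lb; apply: ubnd_lead; first by apply: ubndM; apply: lead_ubnd.
by rewrite lead_coefM ?mulf_neq0 ?lead_coef_neq0 //; apply: lead_ubnd.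
Qed.

Lemma sbnd_reduce f g a b : lead f a -> lead g b -> (b <= a)%MM ->
  sbnd (f - (f@_a / g@_b) *: 'X_[a - b] * g) a.
Proof.
move=> la lb ba; have uq : ubnd ((f@_a / g@_b) *: 'X_[a - b]) (a - b)%MM by apply/ubndZ/ubndX.
apply: lead_cancel; first exact: lead_ubnd.
  by rewrite -[X in ubnd _ X](submK ba); apply: (ubndM uq); apply: lead_ubnd.
rewrite -[X in _ = (_ * _)@_X](submK ba) (lead_coefM uq (lead_ubnd lb)).
by rewrite mcoeffZ mcoeffX eqxx mulr1 divfK // (lead_coef_neq0 lb).
Qed.

Lemma leadXn f a k : lead f a -> lead (f ^+ k) (a *+ k)%MM.
Proof.
move=> la; elim: k => [|k IHk]; last by rewrite exprS mulmS; apply: leadM.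
by rewrite expr0 mulm0n; apply: ubnd_lead; rewrite ?mcoeff1 ?eqxx ?oner_neq0 // -mpolyX0;
  exact: ubndX.
Qed.

Lemma lead_coefXn f a k : lead f a -> (f ^+ k)@_(a *+ k) = f@_a ^+ k.
Proof.
move=> la; elim: k => [|k IHk]; first by rewrite !expr0 mulm0n mcoeff1 eqxx.
rewrite exprS mulmS lead_coefM ?IHk ?exprS //; apply: lead_ubnd => //.
exact: leadXn.
Qed.

Lemma leadX a : lead ('X_[a] : S) a.
Proof. by apply: ubnd_lead; [exact: ubndX|rewrite mcoeffX eqxx oner_neq0]. Qed.

Lemma leadZ c f a : c != 0 -> lead f a -> lead (c *: f) a.
Proof.
move=> c0 la; apply: ubnd_lead; first exact/ubndZ/lead_ubnd.
by rewrite mcoeffZ mulf_neq0 ?lead_coef_neq0.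
Qed.

(** Well-founded induction on the leading monomial, in the form that division needs: a remainder is
    only known to be strictly bounded, and may be 0. *)
Lemma bound_ind (P : S -> Prop) : P 0 ->
  (forall f a, lead f a -> (forall g, sbnd g a -> P g) -> P f) -> forall f, P f.
Proof.
move=> P0 IP f.
case: (eqVneq f 0) => [->//|/lead_exists[a]]; elim/(well_founded_ind (tlt_wf hord)): a f.
move=> a IHa f la; apply: (IP f a la) => g ga.
by case: (eqVneq g 0) => [->//|/lead_exists[b lb]]; apply: (IHa b) => //; case: lb => + _ => /ga.
Qed.

(** The exponents of the monomials of in(I), by [initial_idealX]; most arguments use this set in
    place of the ideal. *)
Definition inM I : set 'X_{1..n} := [set a | exists2 g, I g & lead g a].

Lemma inM_up I a b : is_ideal I -> inM I a -> (a <= b)%MM -> inM I b.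
Proof.
move=> hI [g Ig la] ab; exists ('X_[b - a] * g); first exact: idealMl.
by rewrite -[X in initial_monomial _ _ X](submK ab); apply: leadM => //; apply: leadX.
Qed.

Lemma inM_monic I a : is_ideal I -> inM I a -> exists g, [/\ I g, lead g a & g@_a = 1].
Proof.
move=> hI [g Ig la]; have g0 := lead_coef_neq0 la.
exists ((g@_a)^-1 *: g); split.
- by rewrite -mul_mpolyC; apply: idealMl.
- by apply: leadZ; rewrite ?invr_eq0.
- by rewrite mcoeffZ mulVf.
Qed.

Lemma inMS I J : I `<=` J -> inM I `<=` inM J.
Proof. by move=> IJ a [g /IJ]; exists g. Qed.

(** An element of [J] can be reduced by elements of [I] with the same leading monomial until 0
    remains. *)
Lemma inM_eq I J : is_ideal I -> is_ideal J -> I `<=` J -> inM J `<=` inM I -> I = J.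
Proof.
move=> hI hJ IJ inJ; apply/seteqP; split=> // f; elim/bound_ind: f => [|f a la IHf] Jf.
  exact: ideal0.
have [g [Ig lg g1]] := inM_monic hI (inJ _ (ex_intro2 _ _ f Jf la)).
rewrite -(subrK (f@_a *: g) f); apply: idealD => //; last first.
  by rewrite -mul_mpolyC; apply: idealMl.
apply: IHf; last by apply: idealB => //; apply: IJ; rewrite -mul_mpolyC; apply: idealMl.
apply: lead_cancel; [exact: lead_ubnd|exact/ubndZ/lead_ubnd|].
by rewrite mcoeffZ g1 mulr1.
Qed.

Definition mono_ideal (A : set 'X_{1..n}) : set S :=
  [set p | forall m, m \in msupp p -> A m].

Lemma is_mono_ideal A : (forall a b, A a -> (a <= b)%MM -> A b) ->
  is_ideal (mono_ideal A).
Proof.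
move=> upA; split=> [m|x y Ax Ay m /msuppD_le|y x Ax m /msuppM_le].
- by rewrite msupp0.
- by rewrite mem_cat => /orP[/Ax|/Ay].
- by case/allpairsP=> -[u v] /= [_ /Ax Av ->]; apply: upA Av _; apply: lem_addl.
Qed.

Lemma initial_idealE I : is_ideal I -> initial_ideal ord I = mono_ideal (inM I).
Proof.
move=> hI; apply/seteqP; split.
  apply: smallest_sub; first by apply: is_mono_ideal => a b; apply: inM_up.
  move=> p [f [a [If _ la ->]]] m; rewrite msuppX inE => /eqP->.
  by exists f.
move=> p Ip; rewrite [p]mpolyE big_seq; apply: ideal_sum; first exact: is_ideal_gen.
move=> m /Ip [g Ig lg]; rewrite -mul_mpolyC; apply: (idealMl _ (is_ideal_gen _)).
by apply: sub_gen_smallest; exists g, m; split=> //; exact: (lead_neq0 lg).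
Qed.

Lemma is_ideal_initial I : is_ideal (initial_ideal ord I).
Proof. exact: is_ideal_gen. Qed.

Lemma initial_idealX I a : is_ideal I -> initial_ideal ord I 'X_[a] <-> inM I a.
Proof.
move=> hI; rewrite initial_idealE //; split=> [|Ia m]; first by apply; rewrite msuppX inE.
by rewrite msuppX inE => /eqP->.
Qed.

Lemma initial_idealS I J : is_ideal I -> is_ideal J -> I `<=` J ->
  initial_ideal ord I `<=` initial_ideal ord J.
Proof. by move=> hI hJ IJ; rewrite !initial_idealE // => p Ip m /Ip; apply: inMS. Qed.

Lemma groebner_basis I : is_ideal I -> exists G : seq S,
  (forall g, g \in G -> [/\ I g & g != 0]) /\
  (forall a, inM I a -> exists g b, [/\ g \in G, lead g b & (b <= a)%MM]).
Proof.
move=> hI; have [s [sI sdiv]] := dickson (inM I).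
have /choice[G HG] : forall a, exists g, a \in s -> I g /\ lead g a.
  move=> a; case: (boolP (a \in s)) => [/sI[g Ig la]|_]; first by exists g.
  by exists 0.
exists [seq G a | a <- s]; split=> [g /mapP[a as_ ->]|a /sdiv[b bs ba]].
  by have [? /lead_neq0] := HG a as_.
by exists (G b), b; split=> //; [apply: map_f|have [] := HG b bs].
Qed.

End Leading.

(** * Places and the Frobenius trace *)

(* For [rat] the places are the localizations of the integers at the primes; a
   prime field has the single trivial place, at which [p = 0]. *)
Record place (K : fieldType) := Place {
  char_at : nat;
  int_at : subringClosed K;
  char_at_prime : prime char_at;
  char_at_nunit : forall c, c \in int_at -> c *+ char_at != 1;
  fermat_at : forall c, c \in int_at ->
    exists2 d, d \in int_at & c ^+ char_at - c = d *+ char_at;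
  local_at : forall c, c \in int_at ->
    (forall d, d \in int_at -> c != d *+ char_at) -> c^-1 \in int_at
}.

Definition unit_at (K : fieldType) (v : place K) (c : K) : bool :=
  (c \in int_at v) && (c^-1 \in int_at v).

(* "Almost all" places: those at which finitely many nonzero constants are units. *)
Definition almost_all (K : fieldType) (Q : place K -> Prop) : Prop :=
  exists cs : seq K, all (fun c => c != 0) cs /\ forall v, all (unit_at v) cs -> Q v.

(** This is what keeps statements about almost all places from being vacuous. *)
Definition enough_places (K : fieldType) : Prop :=
  forall cs : seq K, all (fun c => c != 0) cs -> exists v : place K, all (unit_at v) cs.

Section AlmostAll.
Variable K : fieldType.
Implicit Types (P Q : place K -> Prop).

Lemma ae_all P : (forall v, P v) -> almost_all P.
Proof. by exists [::]. Qed.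

Lemma ae_mono P Q : almost_all P -> (forall v, P v -> Q v) -> almost_all Q.
Proof. by move=> [cs [cs0 csP]] PQ; exists cs; split=> // v /csP/PQ. Qed.

Lemma ae_and P Q : almost_all P -> almost_all Q -> almost_all (fun v => P v /\ Q v).
Proof.
move=> [cs [cs0 csP]] [ds [ds0 dsP]]; exists (cs ++ ds); split; first by rewrite all_cat cs0.
by move=> v; rewrite all_cat => /andP[/csP ? /dsP].
Qed.

Lemma ae_unit (c : K) : c != 0 -> almost_all (fun v => unit_at v c).
Proof. by move=> c0; exists [:: c]; split=> [|v]; rewrite /= andbT. Qed.

Lemma ae_seq (T : eqType) (s : seq T) (Q : T -> place K -> Prop) :
  (forall t, t \in s -> almost_all (Q t)) -> almost_all (fun v => forall t, t \in s -> Q t v).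
Proof.
elim: s => [|t s IHs] sQ; first by apply: ae_all.
have tQ := sQ t (mem_head _ _).
have {}IHs : almost_all (fun v => forall t, t \in s -> Q t v).
  by apply: IHs => u us; apply: sQ; rewrite inE us orbT.
by apply: ae_mono (ae_and tQ IHs) _ => v [Qt Qs] u /predU1P[->|/Qs].
Qed.

Lemma ae_exists Q : enough_places K -> almost_all Q -> exists v, Q v.
Proof. by move=> hK [cs [/hK[v csv] csQ]]; exists v; apply: csQ. Qed.

End AlmostAll.

Section IntegralPolynomials.
Variables (n : nat) (K : fieldType).
Local Notation S := {mpoly K[n]}.
Implicit Types (f g h : S) (a b c m : 'X_{1..n}) (v : place K).

Definition intpoly v f : Prop := forall m, f@_m \in int_at v.

Lemma intpolyP v f : intpoly v f <-> f \in mpolyOver n (int_at v).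
Proof. by split=> [h|/mpolyOverP//]; apply/mpolyOverP. Qed.

Lemma intpoly0 v : intpoly v 0. Proof. exact/intpolyP/rpred0. Qed.
Lemma intpolyD v f g : intpoly v f -> intpoly v g -> intpoly v (f + g).
Proof. by move=> /intpolyP ? /intpolyP ?; apply/intpolyP/rpredD. Qed.
Lemma intpolyB v f g : intpoly v f -> intpoly v g -> intpoly v (f - g).
Proof. by move=> /intpolyP ? /intpolyP ?; apply/intpolyP/rpredB. Qed.
Lemma intpolyM v f g : intpoly v f -> intpoly v g -> intpoly v (f * g).
Proof. by move=> /intpolyP ? /intpolyP ?; apply/intpolyP/rpredM. Qed.
Lemma intpolyXn v f k : intpoly v f -> intpoly v (f ^+ k).
Proof. by move=> /intpolyP ?; apply/intpolyP/rpredX. Qed.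
Lemma intpolyMn v f k : intpoly v f -> intpoly v (f *+ k).
Proof. by move=> /intpolyP ?; apply/intpolyP/rpredMn. Qed.
Lemma intpolyZX v (x : K) a : x \in int_at v -> intpoly v (x *: 'X_[a]).
Proof. by move=> xO m; rewrite mcoeffZ mcoeffX rpredM // rpred_nat. Qed.

Lemma ae_coef_unit f : almost_all (fun v => forall m, m \in msupp f -> unit_at v f@_m).
Proof. by apply: ae_seq => m; rewrite mcoeff_msupp => /ae_unit. Qed.

Lemma coef_unit_intpoly v f : (forall m, m \in msupp f -> unit_at v f@_m) -> intpoly v f.
Proof.
move=> fv m; case: (boolP (m \in msupp f)) => [/fv/andP[]//|].
by move/memN_msupp_eq0->; rewrite rpred0.
Qed.

Lemma ae_intpoly f : almost_all (fun v => intpoly v f).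
Proof. exact: ae_mono (ae_coef_unit f) (fun v => @coef_unit_intpoly v f). Qed.

(** Congruence modulo p with an integral quotient; when p is 0 in [K] it is equality. *)
Definition congp v f g : Prop := exists2 d, intpoly v d & f - g = d *+ char_at v.

Lemma congp_refl v f : congp v f f.
Proof. by exists 0; [apply: intpoly0|rewrite subrr mul0rn]. Qed.
Lemma congp_sym v f g : congp v f g -> congp v g f.
Proof.
move=> [d Od e]; exists (0 - d); first exact/intpolyB/Od/intpoly0.
by rewrite -opprB e sub0r mulNrn.
Qed.
Lemma congp_trans v g f h : congp v f g -> congp v g h -> congp v f h.
Proof.
move=> [d Od e] [d' Od' e']; exists (d + d'); first exact: intpolyD.
by rewrite mulrnDl -e -e' addrA subrK.
Qed.
Lemma congpD v f f' g g' : congp v f f' -> congp v g g' -> congp v (f + g) (f' + g').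
Proof.
move=> [d Od e] [d' Od' e']; exists (d + d'); first exact: intpolyD.
by rewrite mulrnDl -e -e' opprD addrACA.
Qed.
Lemma congpMr v f g h : intpoly v h -> congp v f g -> congp v (f * h) (g * h).
Proof.
move=> Oh [d Od e]; exists (d * h); first exact: intpolyM.
by rewrite -mulrBl e mulrnAl.
Qed.

(** The middle binomial coefficients are divisible by p. *)
Lemma congp_exprD v f g : intpoly v f -> intpoly v g ->
  congp v ((f + g) ^+ char_at v) (f ^+ char_at v + g ^+ char_at v).
Proof.
move=> Of Og; have := char_at_prime v; set p := char_at v => pp.
have expand q : (0 < q)%N -> (f + g) ^+ q = f ^+ q + g ^+ q +
    \sum_(i < q.-1) f ^+ (q - i.+1) * g ^+ i.+1 *+ 'C(q, i.+1).
  case: q => // q _; rewrite exprDn big_ord_recl big_ord_recr /= subn0 subnn bin0 binn.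
  by rewrite !mulr1n mulr1 mul1r addrA addrAC.
rewrite expand ?prime_gt0 //.
exists (\sum_(i < p.-1) (f ^+ (p - i.+1) * g ^+ i.+1) *+ ('C(p, i.+1) %/ p)).
  apply/intpolyP/rpred_sum => i _; apply/intpolyP/intpolyMn/intpolyM; exact: intpolyXn.
rewrite -sumrMnl addrC addKr; apply: eq_bigr => i _; rewrite -mulrnA divnK //.
by apply: prime_dvd_bin => //; case: i => i /=; lia.
Qed.

Definition allm1 (p : nat) : 'X_{1..n} := [multinom p.-1 | i < n].

(* Frobenius trace: the additive map with Tr(x^(p c + p - 1)) = x^c, killing the
   monomials whose exponents are not all congruent to -1 mod p. *)
Definition ptrace (p : nat) f : S :=
  \sum_(c : 'X_{1..n < msize f}) f@_(c *+ p + allm1 p) *: 'X_[c].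

(** Truncating the sum at [msize f] loses nothing: for p > 0 the exponent [c *+ p + allm1 p] has at
    least the degree of [c]. *)
Lemma coef_ptrace p f c : (0 < p)%N -> (ptrace p f)@_c = f@_(c *+ p + allm1 p).
Proof.
move=> p0; case: (ltnP (mdeg c) (msize f)) => cf.
  by rewrite /ptrace (mcoeff_mpoly (fun c => f@_(c *+ p + allm1 p)) cf).
rewrite [RHS]memN_msupp_eq0; last first.
  apply: msize_mdeg_ge; apply: (leq_trans cf); rewrite mdegD mdegMn.
  by apply: leq_trans (leq_addr _ _); rewrite leq_pmulr.
apply: memN_msupp_eq0; apply: contraL cf => /msupp_sum_le /flatten_mapP[d _].
by move=> /msuppZ_le; rewrite msuppX inE -ltnNge => /eqP->; apply: bmdeg.
Qed.

Section Trace.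
Variable p : nat.
Hypothesis p0 : (0 < p)%N.

Lemma ptraceD f g : ptrace p (f + g) = ptrace p f + ptrace p g.
Proof. by apply/mpolyP=> m; rewrite mcoeffD !coef_ptrace // mcoeffD. Qed.
Lemma ptraceB f g : ptrace p (f - g) = ptrace p f - ptrace p g.
Proof. by apply/mpolyP=> m; rewrite mcoeffB !coef_ptrace // mcoeffB. Qed.
Lemma ptraceZ x f : ptrace p (x *: f) = x *: ptrace p f.
Proof. by apply/mpolyP=> m; rewrite mcoeffZ !coef_ptrace // mcoeffZ. Qed.
Lemma ptraceMn f k : ptrace p (f *+ k) = ptrace p f *+ k.
Proof. by apply/mpolyP=> m; rewrite mcoeffMn !coef_ptrace // mcoeffMn. Qed.
Lemma ptrace0 : ptrace p 0 = 0.
Proof. by apply/mpolyP=> m; rewrite !coef_ptrace // !mcoeff0. Qed.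

Lemma ptrace_MXp f a : ptrace p (f * 'X_[a *+ p]) = ptrace p f * 'X_[a].
Proof.
apply/mpolyP=> m; rewrite coef_ptrace //; case: (boolP (a <= m)%MM) => am.
  have [d ->] : exists d, m = (a + d)%MM by exists (m - a)%MM; rewrite addmC submK.
  rewrite mcoeffMX coef_ptrace //.
  have -> : ((a + d) *+ p + allm1 p)%MM = (a *+ p + (d *+ p + allm1 p))%MM.
    by apply/mnmP => i; rewrite !(mnmDE, mulmnE); lia.
  by rewrite mcoeffMX.
have nsupp g b d : ~~ (b <= d)%MM -> (g * 'X_[b] : S)@_d = 0.
  move=> bd; apply: memN_msupp_eq0; rewrite (perm_mem (msuppMX g b)).
  by apply: contra bd => /mapP[d' _ ->]; exact: lem_addr.
(* From m_i < a_i follows m_i p + p - 1 < a_i p, so both coefficients vanish. *)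
rewrite !nsupp //; move/mnm_lepP/existsNP: am => [i] /negP; rewrite -ltnNge => mai.
apply/mnm_lepP => /(_ i); rewrite !(mnmDE, mulmnE) /allm1 mnmE => le.
have : (a i * p < (m i).+1 * p)%N by rewrite mulSn; lia.
by rewrite ltn_pmul2r // ltnS leqNgt mai.
Qed.

End Trace.

Lemma ptrace_int v f : intpoly v f -> intpoly v (ptrace (char_at v) f).
Proof. by move=> Of m; rewrite coef_ptrace // prime_gt0 // char_at_prime. Qed.

Lemma ptrace_congp v f g : congp v f g ->
  congp v (ptrace (char_at v) f) (ptrace (char_at v) g).
Proof.
have p0 := prime_gt0 (char_at_prime v).
move=> [d Od e]; exists (ptrace (char_at v) d); first exact: ptrace_int.
by rewrite -ptraceB // e ptraceMn.
Qed.

(** Modulo p the p-th power is additive, so [f] may be taken to be a single term: its monomial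
    leaves the trace by [ptrace_MXp], its coefficient by Fermat's congruence. *)
Lemma ptrace_frobenius v f g : intpoly v f -> intpoly v g ->
  congp v (ptrace (char_at v) (f ^+ char_at v * g)) (f * ptrace (char_at v) g).
Proof.
have p0 := prime_gt0 (char_at_prime v).
move=> + Og; elim/mpolyind: f => [_|c m f mf c0 IHf Ocf].
  by rewrite expr0n gtn_eqF // !mul0r ptrace0 //; apply: congp_refl.
have f0 := memN_msupp_eq0 mf.
have cO : c \in int_at v by have := Ocf m; rewrite mcoeffD mcoeffZ mcoeffX eqxx mulr1 f0 addr0.
have Ocm := intpolyZX m cO.
have Of : intpoly v f by rewrite -(addKr (c *: 'X_[m]) f) addrC; apply: intpolyB.
have := ptrace_congp (congpMr Og (congp_exprD Ocm Of)).
move/congp_trans; apply; rewrite mulrDl ptraceD // mulrDl; apply: congpD; last exact: IHf.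
rewrite exprZn mpolyXn -scalerAl ptraceZ // mulrC ptrace_MXp // [in X in congp _ _ X]mulrC.
rewrite -scalerAr; have [d dO e] := fermat_at cO.
exists (d *: (ptrace (char_at v) g * 'X_[m])).
  by rewrite scalerAr; apply: intpolyM; [apply: ptrace_int|apply: intpolyZX].
by rewrite -scalerBl e scalerMnl.
Qed.

End IntegralPolynomials.

(** * Compatibly split ideals *)

Section Compatible.
Variables (n : nat) (K : fieldType) (ord : rel 'X_{1..n}).
Hypothesis hord : term_order ord.
Local Notation S := {mpoly K[n]}.
Implicit Types (f g h : S) (a b c m : 'X_{1..n}) (v : place K) (I J : set S).
Local Notation lead := (initial_monomial ord).

(** The condition under which division by [I] stays integral at [v]. *)
Definition unit_basis v I : Prop := forall a, inM ord I a ->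
  exists g, [/\ I g, intpoly v g, lead g a & unit_at v g@_a].

Lemma unit_at_div v x y : x \in int_at v -> unit_at v y -> x / y \in int_at v.
Proof. by move=> xO /andP[_ yO]; apply: rpredM. Qed.

Lemma lead_reduce v I f a g : is_ideal I -> lead f a -> intpoly v f ->
  [/\ I g, intpoly v g, lead g a & unit_at v g@_a] ->
  let r := (f@_a / g@_a) *: g in [/\ sbnd ord (f - r) a, intpoly v (f - r) & I r].
Proof.
move=> hI la Of [Ig Og lg ug] /=.
split; last by rewrite -mul_mpolyC; apply: idealMl.
- apply: lead_cancel; [exact: lead_ubnd|exact/ubndZ/lead_ubnd|].
  by rewrite mcoeffZ divfK // (lead_coef_neq0 lg).
- apply: intpolyB => // m; rewrite mcoeffZ; apply: rpredM => //.
  exact: unit_at_div.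
Qed.

Lemma ae_unit_basis I : is_ideal I -> almost_all (fun v => unit_basis v I).
Proof.
move=> hI; have [G [GI Gin]] := groebner_basis ord hI.
apply: ae_mono (ae_seq (fun g (_ : g \in G) => ae_coef_unit g)) _ => v Gv a /Gin.
move=> [g [b [gG lb ba]]]; have [Ig _] := GI g gG; exists ('X_[a - b] * g).
have lg : lead ('X_[a - b] * g) (a - b + b)%MM by apply: (leadM hord) => //; apply: leadX.
rewrite -[X in lead _ X](submK ba) -[X in unit_at _ _@_X](submK ba).
split=> //; first exact: idealMl.
- apply: intpolyM; last exact: coef_unit_intpoly (Gv g gG).
  by rewrite -[X in intpoly _ X]scale1r; apply: intpolyZX; apply: rpred1.
- rewrite (lead_coefM hord) ?mcoeffX ?eqxx ?mul1r; [|exact: ubndX|exact: lead_ubnd].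
  by apply: Gv => //; case: lb.
Qed.

(* The integral version of an inclusion [I <= A] over the field. *)
Lemma ae_submodule I (A : place K -> set S) : is_ideal I ->
  (forall v, A v 0) -> (forall v f g, A v f -> A v g -> A v (f + g)) ->
  (forall v f g, intpoly v f -> A v g -> A v (f * g)) ->
  (forall g, I g -> almost_all (A^~ g)) ->
  almost_all (fun v => forall g, I g -> intpoly v g -> A v g).
Proof.
move=> hI A0 AD AM IA; have [G [GI Gin]] := groebner_basis ord hI.
have GA : almost_all (fun v => forall g, g \in G -> A v g).
  by apply: ae_seq => g /GI[/IA].
apply: ae_mono (ae_and GA (ae_seq (fun g (_ : g \in G) => ae_coef_unit g))) _ => v [{}GA Gv].
move=> f; elim/(@bound_ind n K ord hord): f => [|f a la IHf] If Of; first exact: A0.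
have [g [b [gG lb ba]]] := Gin a (ex_intro2 _ _ f If la); have [Ig _] := GI g gG.
have Og := coef_unit_intpoly (Gv g gG).
have ug : unit_at v g@_b by apply: Gv => //; case: lb.
(* The division step is integral because the leading coefficient of [g] is a unit at [v]. *)
pose q : S := (f@_a / g@_b) *: 'X_[a - b].
have Oq : intpoly v q by apply: intpolyZX; apply: unit_at_div.
rewrite -(subrK (q * g) f); apply: AD; last exact/AM/GA.
have Iq : I (q * g) by exact: idealMl.
apply: IHf; [exact: sbnd_reduce|exact: idealB|by apply/intpolyB/intpolyM].
Qed.

Lemma ae_ideal_add I J : is_ideal I -> is_ideal J -> almost_all (fun v =>
  forall g, ideal_add I J g -> intpoly v g ->
  exists i j, [/\ I i, intpoly v i, J j, intpoly v j & g = i + j]).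
Proof.
move=> hI hJ; apply: (ae_submodule (A := fun v => [set g | exists i j,
  [/\ I i, intpoly v i, J j, intpoly v j & g = i + j]])); first exact: is_ideal_add.
- by move=> v; exists 0, 0; split; rewrite ?addr0 //; by [apply: ideal0|apply: intpoly0].
- move=> v _ _ [i [j [Ii Oi Jj Oj ->]]] [i' [j' [Ii' Oi' Jj' Oj' ->]]].
  by exists (i + i'), (j + j'); split; rewrite 1?addrACA //; by [apply: idealD|apply: intpolyD].
- move=> v f _ Of [i [j [Ii Oi Jj Oj ->]]].
  by exists (f * i), (f * j); split; rewrite ?mulrDr //; by [apply: idealMl|apply: intpolyM].
- move=> _ [i Ii [j Jj <-]].
  apply: ae_mono (ae_and (ae_intpoly i) (ae_intpoly j)) _ => v [Oi Oj].
  by exists i, j.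
Qed.

Definition principal f : set S := [set q * f | q in setT].

Lemma is_ideal_principal f : is_ideal (principal f).
Proof.
split=> [|_ _ [q _ <-] [r _ <-]|g _ [q _ <-]].
- by exists 0; rewrite ?mul0r.
- by exists (q + r); rewrite ?mulrDl.
- by exists (g * q); rewrite ?mulrA.
Qed.

Lemma ae_ideal_add_principal I f : is_ideal I -> almost_all (fun v =>
  forall g, ideal_add I (principal f) g -> intpoly v g ->
  exists i q, [/\ I i, intpoly v i, intpoly v q & g = i + q * f]).
Proof.
move=> hI; apply: (ae_submodule (A := fun v => [set g | exists i q,
  [/\ I i, intpoly v i, intpoly v q & g = i + q * f]])).
- exact/is_ideal_add/is_ideal_principal.
- by move=> v; exists 0, 0; split; rewrite ?mul0r ?addr0 //;
    by [apply: ideal0|apply: intpoly0].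
- move=> v _ _ [i [j [Ii Oi Oj ->]]] [i' [j' [Ii' Oi' Oj' ->]]].
  exists (i + i'), (j + j'); split; rewrite 1?addrACA ?mulrDl //;
    by [apply: idealD|apply: intpolyD].
- move=> v g _ Og [i [j [Ii Oi Oj ->]]].
  by exists (g * i), (g * j); split; rewrite ?mulrDr ?mulrA //;
    by [apply: idealMl|apply: intpolyM].
- move=> _ [i Ii [_ [q _ <-] <-]].
  apply: ae_mono (ae_and (ae_intpoly i) (ae_intpoly q)) _ => v [Oi Oq].
  by exists i, q.
Qed.

(* An ideal is saturated with respect to [p], also when [p = 0] in [K]. *)
Lemma ideal_congp0 v I f d : is_ideal I -> I f -> intpoly v d ->
  f = d *+ char_at v -> exists d', [/\ I d', intpoly v d' & f = d' *+ char_at v].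
Proof.
move=> hI If Od e; case: (eqVneq ((char_at v)%:R : K) 0) => p0.
  exists 0; split; [exact: ideal0|exact: intpoly0|].
  by rewrite e mul0rn -scaler_nat p0 scale0r.
exists d; split=> //; have -> : d = ((char_at v)%:R^-1)%:MP * f; last exact: idealMl.
by rewrite e mul_mpolyC -scaler_nat scalerA mulVf // scale1r.
Qed.

(** Elements common to the reductions of [I] and [J] come from the intersection: by saturation i - j
    = p d' with d' in I + J, and an integral splitting d' = i' + j' gives i - p i' = j + p j'. *)
Lemma ae_cap_lift I J : is_ideal I -> is_ideal J -> almost_all (fun v =>
  forall i j, I i -> intpoly v i -> J j -> intpoly v j -> congp v i j ->
  exists k, [/\ (I `&` J) k, intpoly v k & congp v k i]).
Proof.
move=> hI hJ; apply: ae_mono (ae_ideal_add hI hJ) _ => v split_v i j Ii Oi Jj Oj [d Od e].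
have IJ : ideal_add I J (i - j) by exists i => //; exists (- j) => //; exact: idealN.
have [d' [/split_v + Od' e']] := ideal_congp0 (is_ideal_add hI hJ) IJ Od e.
case=> // i' [j' [Ii' Oi' Jj' Oj' d'E]].
exists (i - i' *+ char_at v); split.
- split; first by apply: idealB => //; rewrite -mulr_natl; apply: idealMl.
  have -> : i - i' *+ char_at v = j + j' *+ char_at v.
    apply/eqP; rewrite subr_eq addrAC -addrA -mulrnDl addrC -subr_eq; apply/eqP.
    by rewrite e' d'E.
  by apply: idealD => //; rewrite -mulr_natl; apply: idealMl.
- exact/intpolyB/intpolyMn.
- exists (0 - i'); first exact/intpolyB/Oi'/intpoly0.
  by rewrite sub0r mulNrn addrAC subrr add0r.
Qed.

Definition colon_elt I f : set S := [set x | I (x * f)].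

Lemma is_ideal_colon_elt I f : is_ideal I -> is_ideal (colon_elt I f).
Proof.
move=> hI; split=> [|x y Ix Iy|a x Ix]; rewrite /colon_elt /=.
- by rewrite mul0r; apply: ideal0.
- by rewrite mulrDl; apply: idealD.
- by rewrite -mulrA; apply: idealMl.
Qed.

(** As for intersections: if x f - i = p (i' + q f), then (x - p q) f = i + p i' is in [I]. *)
Lemma ae_colon_lift I f : is_ideal I -> almost_all (fun v =>
  forall x i, intpoly v x -> I i -> intpoly v i -> congp v (x * f) i ->
  exists k, [/\ colon_elt I f k, intpoly v k & congp v k x]).
Proof.
move=> hI; have hIf := is_ideal_add hI (is_ideal_principal f).
apply: ae_mono (ae_ideal_add_principal f hI) _ => v split_v x i Ox Ii Oi [d Od e].
have IJ : ideal_add I (principal f) (x * f - i).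
  by exists (- i); [exact: idealN|exists (x * f); [exists x|rewrite addrC]].
have [d' [/split_v + Od' e']] := ideal_congp0 hIf IJ Od e.
case=> // i' [q [Ii' Oi' Oq d'E]].
exists (x - q *+ char_at v); split.
- rewrite /colon_elt /= mulrBl -(subrK i (x * f)) e' d'E mulrnDl mulrnAl.
  rewrite addrAC addrK; apply: idealD => //; rewrite -mulr_natl; exact: idealMl.
- exact/intpolyB/intpolyMn.
- exists (0 - q); first exact/intpolyB/Oq/intpoly0.
  by rewrite sub0r mulNrn addrAC subrr add0r.
Qed.

Variable F : S.

(* Modulo [p] this is the Frobenius splitting [Tr (F ^ (p - 1) * _)] of Knutson, for
   which the ideals of the family are compatibly split. *)
Definition splitting v g : S := ptrace (char_at v) (F ^+ (char_at v).-1 * g).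

(** Only the reduction of [I] modulo p is asked to be stable, hence the lift [h]. *)
Definition compatible v I : Prop := forall g, I g -> intpoly v g ->
  exists h, [/\ I h, intpoly v h & congp v h (splitting v g)].

Definition knutson I : Prop := is_ideal I /\ almost_all (compatible^~ I).

Lemma knutson_ideal I : knutson I -> is_ideal I. Proof. by case. Qed.

Lemma knutson_setT : knutson setT.
Proof.
split; first exact: ideal_setT.
apply: ae_mono (ae_intpoly F) _ => v OF g _ Og; exists (splitting v g); split=> //.
  exact/ptrace_int/intpolyM/Og/intpolyXn.
exact: congp_refl.
Qed.

Lemma knutson_add I J : knutson I -> knutson J -> knutson (ideal_add I J).
Proof.
move=> [hI cI] [hJ cJ]; split; first exact: is_ideal_add.
apply: ae_mono (ae_and (ae_and cI cJ) (ae_ideal_add hI hJ)) _ => v [[{}cI {}cJ] sp] g gIJ Og.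
have [i [j [/cI Ii Oi /cJ Jj Oj ->]]] := sp g gIJ Og.
have [[hi [Ih Oh ch]] [hj [Jh Oh' ch']]] := (Ii Oi, Jj Oj).
exists (hi + hj); split; [by exists hi => //; exists hj|exact: intpolyD|].
rewrite /splitting mulrDr ptraceD ?prime_gt0 ?char_at_prime //.
exact: congpD.
Qed.

Lemma knutson_cap I J : knutson I -> knutson J -> knutson (I `&` J).
Proof.
move=> [hI cI] [hJ cJ]; split; first exact: is_ideal_cap.
apply: ae_mono (ae_and (ae_and cI cJ) (ae_cap_lift hI hJ)) _ => v [[{}cI {}cJ] sp].
move=> g [Ig Jg] Og; have [i [Ii Oi ci]] := cI g Ig Og; have [j [Jj Oj cj]] := cJ g Jg Og.
have [k [IJk Ok ck]] := sp i j Ii Oi Jj Oj (congp_trans ci (congp_sym cj)).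
by exists k; split=> //; apply: congp_trans ci.
Qed.

(** For g in I : f the product g f^p is in [I], and its splitting is congruent to f times that of
    [g]; so the splitting of [g] lies in I : f modulo p and lifts. *)
Lemma knutson_colon_elt I f : knutson I -> knutson (colon_elt I f).
Proof.
move=> [hI cI]; split; first exact: is_ideal_colon_elt.
apply: ae_mono (ae_and (ae_and cI (ae_colon_lift f hI))
  (ae_and (ae_intpoly F) (ae_intpoly f))) _ => v [[{}cI lift] [OF Of]] g Ig Og.
have p0 := prime_gt0 (char_at_prime v).
have [|//|i [Ii Oi ci]] := cI (g * f ^+ char_at v).
- by rewrite -(prednK p0) exprS mulrA; apply: idealMr.
- exact/intpolyM/intpolyXn.
have OFg : intpoly v (F ^+ (char_at v).-1 * g) by exact/intpolyM/Og/intpolyXn.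
have [//|k [Ik Ok ck]] := lift (splitting v g) i (ptrace_int OFg) Ii Oi.
  apply: congp_sym; apply: congp_trans ci _.
  rewrite /splitting mulrA [_ * f ^+ _]mulrC [_ * f]mulrC.
  exact: ptrace_frobenius.
by exists k.
Qed.

(** A Groebner basis [G] generates [J], so I : J is the finite intersection of the I : g for g in
    [G]. *)
Lemma knutson_colon I J : knutson I -> is_ideal J -> knutson (ideal_colon I J).
Proof.
move=> kI hJ; have hI := knutson_ideal kI.
have [G [GI Gin]] := groebner_basis ord hJ.
have -> : ideal_colon I J = [set x | forall g, g \in G -> I (x * g)].
  apply/seteqP; split=> x Ix; first by move=> g /GI[/Ix].
  move=> f; elim/(@bound_ind n K ord hord): f => [_|f a la IHf Jf].
    by rewrite mulr0; apply: ideal0.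
  have [g [b [gG lb ba]]] := Gin a (ex_intro2 _ _ f Jf la); have [Jg _] := GI g gG.
  pose q : S := (f@_a / g@_b) *: 'X_[a - b].
  rewrite -(subrK (q * g) f) mulrDr; apply: idealD => //; last first.
    by rewrite mulrCA; apply: idealMl => //; apply: Ix.
  apply: IHf; first exact: sbnd_reduce.
  by apply: idealB => //; apply: idealMl.
elim: G {GI Gin} => [|g G IHG].
  suff -> : [set x | forall g, g \in [::] -> I (x * g)] = setT by exact: knutson_setT.
  by apply/seteqP; split.
suff -> : [set x | forall h, h \in g :: G -> I (x * h)] =
    colon_elt I g `&` [set x | forall h, h \in G -> I (x * h)].
  by apply: knutson_cap => //; apply: knutson_colon_elt.
apply/seteqP; split=> x; last by move=> [Ig IG] h /predU1P[->//|/IG].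
by move=> Ix; split=> [|h hG]; apply: Ix; rewrite inE ?eqxx ?hG ?orbT.
Qed.

(** Here F^(p-1) q f = f^p r^(p-1) q, and the trace releases one factor [f] modulo p. *)
Lemma knutson_principal f r : F = f * r -> knutson (principal f).
Proof.
move=> FE; split; first exact: is_ideal_principal.
(* Applied to the zero ideal, [ae_ideal_add_principal] provides integral cofactors for integral
   multiples of [f]. *)
have h0 : is_ideal [set (0 : S)].
  by split=> [//|x y -> ->|x y ->]; rewrite /= ?addr0 ?mulr0.
apply: ae_mono (ae_and (ae_ideal_add_principal f h0) (ae_and (ae_intpoly f) (ae_intpoly r))) _.
move=> v [sp [Of Or]] g gf Og; have p0 := prime_gt0 (char_at_prime v).
have [|_ [q [-> _ Oq gE]]] := sp g _ Og.
  by exists 0 => //; exists g; rewrite ?add0r.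
have Orq : intpoly v (r ^+ (char_at v).-1 * q) by exact/intpolyM/Oq/intpolyXn.
exists (f * ptrace (char_at v) (r ^+ (char_at v).-1 * q)); split.
- by rewrite mulrC; exists (ptrace (char_at v) (r ^+ (char_at v).-1 * q)).
- exact/intpolyM/ptrace_int.
apply: congp_sym; have := ptrace_frobenius Of Orq.
rewrite /splitting gE add0r FE exprMn.
rewrite (_ : _ * r ^+ _ * (q * f) = f ^+ char_at v * (r ^+ (char_at v).-1 * q)) //.
by rewrite -[in RHS](prednK p0) exprS; ring.
Qed.

End Compatible.

(** * Initial ideals of compatibly split ideals *)

Section Degeneration.
Variables (n : nat) (K : fieldType) (ord : rel 'X_{1..n}).
Hypothesis hord : term_order ord.
Local Notation S := {mpoly K[n]}.
Implicit Types (f g h : S) (a b c m : 'X_{1..n}) (v : place K) (I J : set S).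
Local Notation lead := (initial_monomial ord).
Local Notation inM := (inM ord).

Definition multiple_at v (c : K) : Prop := exists2 d, d \in int_at v & c = d *+ char_at v.

Lemma multiple_atD v x y : multiple_at v x -> multiple_at v y -> multiple_at v (x + y).
Proof.
by move=> [d dO ->] [e eO ->]; exists (d + e); rewrite ?mulrnDl //; apply: rpredD.
Qed.

Lemma multiple_atM v x y : x \in int_at v -> multiple_at v y -> multiple_at v (x * y).
Proof. by move=> xO [d dO ->]; exists (x * d); rewrite ?mulrnAr //; apply: rpredM. Qed.

Lemma multiple_at_unit v x : x != 0 -> unit_at v x -> ~ multiple_at v x.
Proof.
move=> x0 /andP[xO xVO] [d dO xE].
by have := char_at_nunit (rpredM xVO dO); rewrite -mulrnAr -xE mulVf // eqxx.
Qed.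

(** A leading monomial modulo p is a leading monomial of [I]: as long as the leading monomial of [f]
    is above [b], its coefficient is divisible by p, and cancelling it changes [f] only by multiples
    of p. *)
Lemma residue_lead v I f b : is_ideal I -> unit_basis ord v I -> I f -> intpoly v f ->
  ~ multiple_at v f@_b -> (forall m, tlt ord b m -> multiple_at v f@_m) -> inM I b.
Proof.
move=> hI ub; elim/(@bound_ind n K ord hord): f => [|f a la IHf] If Of fb fm.
  by case: fb; exists 0; rewrite ?rpred0 ?mcoeff0 ?mul0rn.
have [<-|ab] := eqVneq a b; first by exists f.
case: (boolP (tlt ord b a)) => [ba|/(tord_nlt hord) ab']; last first.
  case: fb; rewrite (ubnd_coef0 hord (lead_ubnd la)); last by rewrite /tlt ab'.
  by exists 0; rewrite ?rpred0 ?mul0rn.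
have Ia : inM I a by exists f.
have [g [Ig Og lg ug]] := ub a Ia.
have [sr Or Ir] := lead_reduce hI la Of (And4 Ig Og lg ug).
have mr m : multiple_at v ((f@_a / g@_a) *: g)@_m.
  rewrite mcoeffZ -mulrA mulrC; apply: multiple_atM; last exact: fm.
  by apply: rpredM => //; case/andP: ug.
apply: (IHf (f - (f@_a / g@_a) *: g)) => //; first exact: idealB.
- move=> fb'; apply: fb; rewrite -(subrK ((f@_a / g@_a) *: g) f) mcoeffD.
  exact: multiple_atD.
- move=> m bm; rewrite mcoeffB -mulN1r; apply: multiple_atD; first exact: fm.
  by apply: multiple_atM => //; rewrite rpredN rpred1.
Qed.

Definition ones : 'X_{1..n} := [multinom 1%N | i < n].

Variable F : S.
Hypothesis F_lead : lead F ones.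

(** The trace sends the leading term of F^(p-1) g, of exponent [allm1 n p + b *+ p], to x^b with a
    unit coefficient; a larger monomial of the trace would come from above that leading term. So x^b
    leads the lift [h] modulo p. *)
Lemma inM_root v I b : is_ideal I -> compatible F v I -> unit_basis ord v I ->
  intpoly v F -> unit_at v F@_ones -> inM I (b *+ char_at v)%MM -> inM I b.
Proof.
move=> hI cI ubI OF uF /ubI[g [Ig Og lg ug]]; have p0 := prime_gt0 (char_at_prime v).
set p := char_at v in p0 lg ug *.
have [h [Ih Oh [d Od dE]]] := cI g Ig Og.
have l : lead (F ^+ p.-1 * g) (allm1 n p + b *+ p)%MM.
  apply: (leadM hord) => //; have -> : allm1 n p = (ones *+ p.-1)%MM.
    by apply/mnmP => i; rewrite mulmnE !mnmE mul1n.
  exact: leadXn.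
have hE m : h@_m = (F ^+ p.-1 * g)@_(m *+ p + allm1 n p) + d@_m *+ p.
  by rewrite -(subrK (splitting F v g) h) dE mcoeffD mcoeffMn coef_ptrace // addrC.
apply: (residue_lead hI ubI Ih Oh) => [|m bm].
- rewrite hE => hm; have : multiple_at v (F ^+ p.-1 * g)@_(b *+ p + allm1 n p).
    rewrite -[X in multiple_at _ X](addrK (d@_b *+ p)) -mulNrn.
    by apply: multiple_atD => //; exists (- d@_b); rewrite // rpredN.
  apply: multiple_at_unit; first by rewrite addmC (lead_coef_neq0 l).
  rewrite addmC; have -> : allm1 n p = (ones *+ p.-1)%MM.
    by apply/mnmP => i; rewrite mulmnE !mnmE mul1n.
  rewrite (lead_coefM hord) ?(lead_coefXn hord) //; last 2 first.
  - exact/lead_ubnd/leadXn.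
  - exact: lead_ubnd.
  move: uF ug => /andP[? ?] /andP[? ?]; rewrite /unit_at invfM -exprVn.
  by rewrite !rpredM ?rpredX.
- rewrite hE; apply: multiple_atD; last by exists d@_m.
  rewrite (ubnd_coef0 hord (lead_ubnd l)); first by exists 0; rewrite ?rpred0 ?mul0rn.
  rewrite [X in tlt _ _ X]addmC; apply: (tlt_add hord (tord_refl hord _)).
  exact: tlt_muln.
Qed.

Hypothesis hK : enough_places K.

Local Notation knutson := (knutson F).

(** At a single good place, x^a divides the p^e-th power of x^b for e = [mdeg a], because p^e > e,
    and [inM_root] extracts p-th roots e times. *)
Lemma inM_radical I a b : knutson I -> inM I a ->
  (forall i, b i = 0%N -> a i = 0%N) -> inM I b.
Proof.
move=> [hI cI] Ia ab.
have [v [[{}cI ub] [OF uF]]] := ae_exists hK (ae_and (ae_and cI (ae_unit_basis hord hI))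
  (ae_and (ae_intpoly F) (ae_unit (lead_coef_neq0 F_lead)))).
have root e : inM I (b *+ char_at v ^ e)%MM -> inM I b.
  elim: e => [|e IHe]; first by rewrite expn0 mulm1n.
  rewrite expnSr => h; apply: IHe; apply: (inM_root hI cI ub OF uF).
  by have -> : (b *+ char_at v ^ e *+ char_at v = b *+ (char_at v ^ e * char_at v))%MM;
    [apply/mnmP => i; rewrite !mulmnE mulnA|].
apply: (root (mdeg a)); apply: (inM_up hord hI Ia); apply/mnm_lepP => i; rewrite mulmnE.
case: (posnP (b i)) => [/ab->//|b0].
apply: (@leq_trans (char_at v ^ mdeg a)); last by rewrite leq_pmull.
apply: leq_trans (ltnW (ltn_expl _ (prime_gt1 (char_at_prime v)))).
by rewrite mdegE (bigD1 i) //= leq_addr.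
Qed.

(** The product f g lies in both ideals and has leading monomial x^(2a); radicality removes the
    square. *)
Lemma inM_cap I J a : knutson I -> knutson J -> inM I a -> inM J a -> inM (I `&` J) a.
Proof.
move=> kI kJ [f If la] [g Jg lb].
apply: (inM_radical (a := (a + a)%MM)); first exact: (knutson_cap hord).
  exists (f * g); last exact: leadM.
  by split; [apply: idealMr => //; case: kI|apply: idealMl => //; case: kJ].
by move=> i; rewrite mnmDE => ->.
Qed.

(** Of two distinct leading monomials the larger survives in f + g. If they coincide, some [k] in
    the intersection has the same one by [inM_cap], and moving a multiple of [k] from [f] to [g]
    lowers [f] while keeping the sum. *)
Lemma inM_add I J b : knutson I -> knutson J -> inM (ideal_add I J) b -> inM I b \/ inM J b.
Proof.
move=> kI kJ [_ [f If [g Jg <-]]].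
elim/(@bound_ind n K ord hord): f g If Jg => [|f a la IHf] g If Jg.
  by rewrite add0r; right; exists g.
case: (eqVneq g 0) Jg => [->|/(lead_exists hord)[a' la']] Jg lb.
  by left; exists f; rewrite // -[f]addr0.
case: (eqVneq a a') => [|ne]; last first.
  case/orP: (term_order_total hord a a') => aa'.
    right; exists g => //; suff -> : b = a' by [].
    apply: (lead_uniq hord lb); apply: ubnd_lead.
      by apply: ubndD; [apply: (ubndS hord) (lead_ubnd la) aa'|apply: lead_ubnd].
    rewrite mcoeffD (ubnd_coef0 hord (lead_ubnd la)) ?add0r ?(lead_coef_neq0 la') //.
    by rewrite /tlt aa'.
  left; exists f => //; suff -> : b = a by [].
  apply: (lead_uniq hord lb); apply: ubnd_lead.
    by apply: ubndD; [apply: lead_ubnd|apply: (ubndS hord) (lead_ubnd la') aa'].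
  rewrite mcoeffD (ubnd_coef0 hord (lead_ubnd la')) ?addr0 ?(lead_coef_neq0 la) //.
  by rewrite /tlt aa' eq_sym.
move=> e; rewrite -{a'}e in la'.
have hI := knutson_ideal kI; have hJ := knutson_ideal kJ.
have Ia : inM (I `&` J) a by apply: inM_cap => //; [exists f|exists g].
have [k [[Ik Jk] lk k1]] := inM_monic (is_ideal_cap hI hJ) Ia.
apply: (IHf (f - f@_a *: k) _ (g + f@_a *: k)).
- by apply: lead_cancel; [apply: lead_ubnd|apply/ubndZ/lead_ubnd|rewrite mcoeffZ k1 mulr1].
- by apply: idealB => //; rewrite -mul_mpolyC; apply: idealMl.
- by apply: idealD => //; rewrite -mul_mpolyC; apply: idealMl.
- by have -> : f - f@_a *: k + (g + f@_a *: k) = f + g by ring.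
Qed.

Definition indic (B : {set 'I_n}) : 'X_{1..n} := [multinom (i \in B : nat) | i < n].
Definition msetsupp a : {set 'I_n} := [set i | a i != 0%N].

(** For a [knutson] ideal this finite set determines [inM I]; its cardinality bounds chains of such
    ideals. *)
Definition squarefree_in I : {set {set 'I_n}} := [set B | `[< inM I (indic B) >]].

Lemma inM_indic I a : knutson I -> inM I a <-> inM I (indic (msetsupp a)).
Proof.
move=> kI; split=> Ia.
  apply: (inM_radical kI Ia) => i; rewrite /indic mnmE inE.
  by case: eqP.
apply: (inM_up hord (knutson_ideal kI) Ia); apply/mnm_lepP => i.
by rewrite mnmE inE; case: (a i).
Qed.

Lemma squarefree_in_proper I J : knutson I -> knutson J -> I `<` J ->
  (#|squarefree_in I| < #|squarefree_in J|)%N.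
Proof.
move=> kI kJ [IJ nJI]; have hI := knutson_ideal kI; have hJ := knutson_ideal kJ.
apply: proper_card; apply/properP; split.
  by apply/fintype.subsetP => B; rewrite !inE => -[g /IJ]; exists g.
apply: contrapT => nex; apply: nJI.
suff e : I = J by rewrite -e.
apply: (inM_eq hord hI hJ IJ) => a /(proj1 (inM_indic a kJ)) Ja.
apply: (proj2 (inM_indic a kI)); apply: contrapT => nIa; apply: nex.
by exists (msetsupp a); rewrite inE; [exact/asboolP|exact/asboolPn].
Qed.

(** Radicality puts the leading monomial of [f] in in(I), and reducing [f] by an element of [I]
    keeps its square in [I]. *)
Lemma knutson_sqr I f : knutson I -> I (f * f) -> I f.
Proof.
move=> kI; have hI := knutson_ideal kI.
elim/(@bound_ind n K ord hord): f => [//|f a la IHf Iff]; first by move=> _; exact: ideal0.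
have Ia : inM I a.
  apply: (inM_radical (a := (a + a)%MM)) => //; first by exists (f * f) => //; apply: leadM.
  by move=> i; rewrite mnmDE => ->.
have [k [Ik lk k1]] := inM_monic hI Ia.
have Ifk : I (f@_a *: k) by rewrite -mul_mpolyC; apply: idealMl.
rewrite -(subrK (f@_a *: k) f); apply: idealD => //; apply: IHf.
  by apply: lead_cancel; [apply: lead_ubnd|apply/ubndZ/lead_ubnd|rewrite mcoeffZ k1 mulr1].
have -> : (f - f@_a *: k) * (f - f@_a *: k) = f * f - (f@_a *: k) * (f + f - f@_a *: k).
  by ring.
by apply: idealB => //; apply: idealMr.
Qed.

Definition meet (s : seq (set S)) : set S := [set x | forall P, P \in s -> P x].

Lemma is_ideal_meet s : (forall P, P \in s -> is_ideal P) -> is_ideal (meet s).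
Proof.
move=> sI; split=> [P /sI|x y xs ys P Ps|a x xs P Ps]; first exact: ideal0.
- by apply: (idealD (sI P Ps)); [apply: xs|apply: ys].
- by apply: (idealMl _ (sI P Ps)); apply: xs.
Qed.

Lemma meet_cons P s : meet (P :: s) = P `&` meet s.
Proof.
apply/seteqP; split=> x; last by move=> [Px sx] Q /predU1P[->|/sx].
by move=> xs; split=> [|Q Qs]; apply: xs; rewrite inE ?eqxx ?Qs ?orbT.
Qed.

Lemma prime_meet s P : (forall Q, Q \in s -> is_ideal Q) -> prime_ideal P ->
  meet s `<=` P -> exists2 Q, Q \in s & Q `<=` P.
Proof.
move=> sI hP sP; apply: contrapT => nex.
have /choice[x Hx] : forall Q, exists x, Q \in s -> Q x /\ ~ P x.
  move=> Q; case: (boolP (Q \in s)) => [Qs|_]; last by exists 0.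
  case: (pselect (exists x, Q x /\ ~ P x)) => [[x ?]|nx]; first by exists x.
  by case: nex; exists Q => // y Qy; apply: contrapT => nPy; apply: nx; exists y.
have [Q Qs PQ] : exists2 Q, Q \in s & P (x Q); last by have [] := Hx Q Qs.
apply: prime_prod => //; apply: sP => Q Qs; rewrite (big_rem Q) //=.
by apply: idealMr; [apply: sI|have [] := Hx Q Qs].
Qed.

(* A radical ideal with [x * y] in I equals [(I : x) :&: (I : (I : x))]. *)
Lemma knutson_decomposition I : knutson I -> exists s : seq (set S),
  (forall P, P \in s -> knutson P /\ prime_ideal P) /\ I = meet s.
Proof.
have [k] := ubnP (#|{: {set 'I_n}}| - #|squarefree_in I|).
elim: k I => // k IHk I Ik kI; have hI := knutson_ideal kI.
case: (pselect (I = setT)) => [->|IT].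
  by exists [::]; split=> //; apply/seteqP; split.
case: (pselect (prime_ideal I)) => [pI|npI].
  exists [:: I]; split=> [P|]; first by rewrite inE => /eqP->.
  by apply/seteqP; split=> x Ix; [move=> P; rewrite inE => /eqP->|apply: Ix; rewrite mem_head].
have [x [y [Ixy nIx nIy]]] : exists x y, [/\ I (x * y), ~ I x & ~ I y].
  apply: contrapT => nex; apply: npI; split=> // x y Ixy.
  apply: contrapT => /not_orP[nx ny]; apply: nex; by exists x, y.
pose I1 := colon_elt I x; pose I2 := ideal_colon I I1.
have kI1 : knutson I1 by exact: (knutson_colon_elt hord).
have hI1 := knutson_ideal kI1.
have kI2 : knutson I2 by exact: (knutson_colon hord).
have II1 : I `<=` I1 by move=> z Iz; apply: idealMr.
have II2 : I `<=` I2 by move=> z Iz w _; apply: idealMr.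
(* The induction measure is the number of square-free monomials outside the initial ideal. *)
have step J : knutson J -> I `<` J ->
    (#|{: {set 'I_n}}| - #|squarefree_in J| < k)%N.
  move=> kJ /(squarefree_in_proper kI kJ) lt.
  have le : (#|squarefree_in J| <= #|{: {set 'I_n}}|)%N := max_card _.
  by rewrite -ltnS; apply: leq_trans Ik; rewrite ltnS ltn_sub2l // (leq_trans lt).
have [|s1 [s1P I1E]] := IHk I1 _ kI1.
  by apply: step => //; split=> // h; apply: nIy; apply: h; rewrite /I1 /colon_elt /= mulrC.
have [|s2 [s2P I2E]] := IHk I2 _ kI2.
  by apply: step => //; split=> // h; apply: nIx; apply: h => z; rewrite mulrC.
exists (s1 ++ s2); split=> [P|]; first by rewrite mem_cat => /orP[/s1P|/s2P].
apply/seteqP; split=> z Iz.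
  move=> P; rewrite mem_cat => /orP[Ps|Ps].
    by have := II1 z Iz; rewrite I1E; apply.
  by have := II2 z Iz; rewrite I2E; apply.
(* An element of both [I1] and I : I1 has its square in [I]. *)
apply: knutson_sqr => //.
have I1z : I1 z by rewrite I1E => P Ps; apply: Iz; rewrite mem_cat Ps.
have I2z : I2 z by rewrite I2E => P Ps; apply: Iz; rewrite mem_cat Ps orbT.
exact: I2z.
Qed.

End Degeneration.

(** * Places of the rationals and of prime fields *)

Definition localized_int (p : nat) : {pred rat} := fun x =>
  `[< exists (a : int) (b : nat), [/\ coprime p b, (0 < b)%N & x = a%:~R / b%:R] >].

Lemma localized_intP p x : reflect
  (exists (a : int) (b : nat), [/\ coprime p b, (0 < b)%N & x = a%:~R / b%:R])
  (x \in localized_int p).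
Proof. exact: asboolP. Qed.

Lemma localized_int_subring p : subring_closed (localized_int p).
Proof.
split.
- by apply/localized_intP; exists 1, 1%N; rewrite coprimen1 divr1.
- move=> x y /localized_intP[a [b [pb b0 ->]]] /localized_intP[a' [b' [pb' b0' ->]]].
  apply/localized_intP; exists (a * b'%:Z - a' * b%:Z), (b * b')%N.
  rewrite coprimeMr pb pb' muln_gt0 b0 b0'; split=> //.
  rewrite rmorphB !rmorphM /= -!pmulrn ?natrM.
  by field; rewrite !pnatr_eq0 -!lt0n b0 b0'.
- move=> x y /localized_intP[a [b [pb b0 ->]]] /localized_intP[a' [b' [pb' b0' ->]]].
  apply/localized_intP; exists (a * a'), (b * b')%N.
  rewrite coprimeMr pb pb' muln_gt0 b0 b0'; split=> //.
  rewrite rmorphM /= ?natrM.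
  by field; rewrite !pnatr_eq0 -!lt0n b0 b0'.
Qed.

HB.instance Definition _ p :=
  GRing.isSubringClosed.Build rat (localized_int p) (localized_int_subring p).

Lemma fermat_int p (a : int) : prime p -> (p%:Z %| a ^+ p - a)%Z.
Proof.
move=> pp; have := dvdz_pcharf (pchar_Fp pp) (a ^+ p - a) => ->.
by rewrite rmorphB rmorphXn /= -(pFrobenius_autE (pchar_Fp pp)) rmorph_int subrr.
Qed.

Lemma localized_int_nunit p x : prime p -> x \in localized_int p -> x *+ p != 1.
Proof.
move=> pp /localized_intP[a [b [pb b0 ->]]]; apply/eqP => e.
have bn0 : b%:R != 0 :> rat by rewrite pnatr_eq0 -lt0n.
have : (a * p%:Z)%:~R = (b%:Z)%:~R :> rat.
  have := congr1 (fun z => z * b%:R) e.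
  by rewrite mul1r mulrnAl divfK // rmorphM /= -!pmulrn mulr_natr.
move/(mulrIz (oner_neq0 _)) => abE.
move: pb; rewrite prime_coprime // => /negP; apply.
by rewrite -[b]/`|b%:Z|%N -abE abszM dvdn_mull.
Qed.

Lemma localized_int_fermat p x : prime p -> x \in localized_int p ->
  exists2 d, d \in localized_int p & x ^+ p - x = d *+ p.
Proof.
move=> pp /localized_intP[a [b [pb b0 ->]]].
have bn0 : b%:R != 0 :> rat by rewrite pnatr_eq0 -lt0n.
(* This is the numerator of x^p - x over the denominator b^(p+1); Fermat for [a] and for [b] makes
   it divisible by p. *)
have /dvdzP[q qE] : (p%:Z %| a ^+ p * b%:Z - a * b%:Z ^+ p)%Z.
  have -> : a ^+ p * b%:Z - a * b%:Z ^+ p = (a ^+ p - a) * b%:Z - a * (b%:Z ^+ p - b%:Z).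
    by ring.
  by apply: rpredB; [apply: dvdz_mulr|apply: dvdz_mull]; apply: fermat_int.
exists (q%:~R / (b ^ p.+1)%:R).
  by apply/localized_intP; exists q, (b ^ p.+1)%N; rewrite coprimeXr // expn_gt0 b0.
have := congr1 (fun z : int => z%:~R : rat) qE.
rewrite rmorphB !rmorphM !rmorphXn /= -!pmulrn => e.
rewrite -[RHS]mulr_natr [RHS]mulrAC -e exprS expr_div_n.
have := expf_neq0 p bn0; move: (b%:R ^+ p) (a%:~R ^+ p) => B A B0.
by field; rewrite B0 bn0.
Qed.

Lemma localized_int_local p x : prime p -> x \in localized_int p ->
  (forall d, d \in localized_int p -> x != d *+ p) -> x^-1 \in localized_int p.
Proof.
move=> pp /localized_intP[a [b [pb b0 ->]]] nd.
have pa : coprime p `|a|.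
  rewrite prime_coprime //; apply/negP; rewrite -[p]/`|p%:Z|%N => /dvdzP[q qE].
  have /nd/eqP : q%:~R / b%:R \in localized_int p by apply/localized_intP; exists q, b.
  by apply; rewrite qE rmorphM /= -[RHS]mulr_natr mulrAC -pmulrn.
have a0 : (0 < `|a|)%N.
  by case: posnP pa => // ->; rewrite /coprime gcdn0 => /eqP p1; rewrite p1 in pp.
apply/localized_intP; exists (sgz a * b%:Z), `|a|%N; split=> //.
have an0 : a%:~R != 0 :> rat by rewrite intr_eq0 -absz_gt0.
have s0 : (sgz a)%:~R != 0 :> rat by rewrite intr_eq0 sgz_eq0 -absz_gt0.
rewrite [X in _ = _ / X]pmulrn abszEsg invf_div !rmorphM /= -pmulrn.
by field; rewrite an0.
Qed.

Definition rat_place p (pp : prime p) : place rat :=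
  @Place rat p (localized_int p) pp
    (fun x => @localized_int_nunit p x pp) (fun x => @localized_int_fermat p x pp)
    (fun x => @localized_int_local p x pp).

Lemma rat_enough_places : enough_places rat.
Proof.
(* A prime above [m] divides none of the numerators and denominators. *)
move=> cs cs0; pose m := \max_(c <- cs) (`|numq c| + `|denq c|)%N.
have [p mp pp] := prime_above m; exists (rat_place pp); apply/allP => c cs_c.
have := @leq_bigmax_seq _ cs xpredT (fun c : rat => `|numq c| + `|denq c|)%N c cs_c isT.
rewrite -/m => cm; have c0 : c != 0 := allP cs0 c cs_c.
have small k : (0 < k)%N -> (k <= m)%N -> coprime p k.
  move=> k0 km; rewrite prime_coprime //; apply: contraL mp => /(dvdn_leq k0) pk.
  by rewrite -leqNgt (leq_trans pk).
have d0 : (0 < `|denq c|)%N by rewrite absz_gt0 denq_neq0.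
have n0 : (0 < `|numq c|)%N by rewrite absz_gt0 numq_eq0.
have cO : c \in localized_int p.
  apply/localized_intP; exists (numq c), `|denq c|%N; split=> //.
    by apply: small => //; apply: leq_trans cm; rewrite leq_addl.
  by rewrite [X in _ / X]pmulrn absz_denq divq_num_den.
rewrite /unit_at cO /=; apply: localized_int_local => // d /localized_intP[a [b [pb b0 ->]]].
apply/eqP => cE; have : coprime p `|numq c|.
  by apply: small => //; apply: leq_trans cm; rewrite leq_addr.
rewrite prime_coprime // => /negP; apply.
have bn0 : b%:R != 0 :> rat by rewrite pnatr_eq0 -lt0n.
have dn0 : (denq c)%:~R != 0 :> rat by rewrite intr_eq0 denq_neq0.
have : (numq c * b%:Z)%:~R = (a * p%:Z * denq c)%:~R :> rat.
  rewrite !rmorphM /= -!pmulrn.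
  have -> : (numq c)%:~R = c * (denq c)%:~R :> rat.
    by rewrite -[X in _ = X * _]divq_num_den divfK.
  by rewrite cE -mulr_natr; field.
move/(mulrIz (oner_neq0 _)) => /(congr1 absz); rewrite !abszM /= => e.
by rewrite -(Gauss_dvdl _ pb) e mulnAC dvdn_mull.
Qed.

Definition total_pred (K : fieldType) : {pred K} := fun _ => true.

Lemma total_pred_subring (K : fieldType) : subring_closed (@total_pred K).
Proof. by []. Qed.

HB.instance Definition _ (K : fieldType) :=
  GRing.isSubringClosed.Build K (@total_pred K) (@total_pred_subring K).

(** The whole field serves as the ring of integers, so every constant is a unit. *)
Lemma Fp_enough_places p : prime p -> enough_places 'F_p.
Proof.
move=> pp; have p0 : p%:R = 0 :> 'F_p by rewrite pchar_Fp_0.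
have nunit (c : 'F_p) : c \in @total_pred 'F_p -> c *+ p != 1.
  by rewrite -mulr_natr p0 mulr0 eq_sym oner_neq0.
have fermat (c : 'F_p) : c \in @total_pred 'F_p ->
    exists2 d, d \in @total_pred 'F_p & c ^+ p - c = d *+ p.
  exists 0 => //; rewrite mul0rn -(pFrobenius_autE (pchar_Fp pp)).
  by rewrite -[c]natr_Zp rmorph_nat subrr.
by exists (@Place 'F_p p (@total_pred 'F_p) pp nunit fermat (fun _ _ _ => isT)); apply/allP.
Qed.

(** * Independent variables modulo a prime *)

Section PolynomialExtension.
Variable R : comNzRingType.

(** If [a] and [b] are the highest degrees in which the coefficients of [q] and [r] are outside [P],
    the coefficient of q r in degree a + b is their product modulo [P]. *)
Lemma prime_poly (P : set R) : prime_ideal P ->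
  prime_ideal [set q : {poly R} | forall k, P q`_k].
Proof.
move=> hP; have hI := prime_is_ideal hP; split.
- split=> [k|p q Pp Pq k|a q Pq k]; rewrite ?coef0 ?coefD ?coefM.
  + exact: ideal0.
  + exact: idealD.
  + by apply: ideal_sum => // i _; apply: idealMl.
- move=> /seteqP[_ /(_ 1 I) /(_ 0%N)]; rewrite coef1 => ?; exact: (prime_not1 hP).
have top (q : {poly R}) : (exists k, ~ P q`_k) ->
    exists a, ~ P q`_a /\ forall j, (a < j)%N -> P q`_j.
  move=> [k nPk]; have exP : exists k, `[< ~ P q`_k >] by exists k; apply/asboolP.
  have ubP j : `[< ~ P q`_j >] -> (j <= size q)%N.
    move/asboolP=> nPj; rewrite leqNgt; apply/negP => lt; apply: nPj.
    by rewrite nth_default ?(ltnW lt) //; apply: ideal0.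
  case: (ex_maxnP exP ubP) => a /asboolP nPa amax; exists a; split=> // j aj.
  by apply: contrapT => nPj; have := amax j (asboolT nPj); rewrite leqNgt aj.
move=> q r Pqr; apply: contrapT => /not_orP[/existsNP/top[a [nPa aP]] /existsNP/top[b [nPb bP]]].
have := Pqr (a + b)%N; rewrite coefM.
have lt : (a < (a + b).+1)%N by rewrite ltnS leq_addr.
rewrite (bigD1 (Ordinal lt)) //= addKn => Pab.
suff /(primeM hP)[] : P (q`_a * r`_b) by [].
apply: (idealDr hI _ Pab); apply: ideal_sum => // -[i ilt]; rewrite -val_eqE /= => ia.
case: (ltngtP i a) ia => // [ia|ai] _.
- by apply: (idealMl _ hI); apply: bP; rewrite ltn_subRL ltn_add2r.
- by apply: (idealMr _ hI); apply: aP.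
Qed.

Lemma prime_preimage (R' : comNzRingType) (phi : {rmorphism R -> R'}) (P : set R') :
  prime_ideal P -> prime_ideal [set x | P (phi x)].
Proof.
move=> hP; have hI := prime_is_ideal hP; split.
- split=> [|x y|a x] /=; rewrite ?rmorph0 ?rmorphD ?rmorphM; first exact: ideal0.
    exact: idealD.
  exact: idealMl.
- by move=> /seteqP[_ /(_ 1 I)] /=; rewrite rmorph1; apply: prime_not1.
- by move=> x y /=; rewrite rmorphM; apply: primeM.
Qed.

Lemma prime_chainS (P Q : set R) k : prime_ideal Q -> P `<` Q ->
  prime_chain P k -> prime_chain Q k.+1.
Proof.
move=> hQ PQ [C [Cprime Clt Ck]]; exists (fun i => if (i <= k)%N then C i else Q).
split=> [i ik|i ik|]; last by rewrite ltnn.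
  by case: leqP => // /Cprime.
rewrite ltnS in ik; rewrite ik; case: (ltnP i k) => [/Clt //|ki].
by have -> : i = k; [apply/eqP; rewrite eqn_leq ik ki|rewrite Ck].
Qed.

Lemma prime_chain0 (P : set R) : prime_ideal P -> prime_chain P 0.
Proof. by move=> hP; exists (fun=> P). Qed.

End PolynomialExtension.

Section Independence.
Variables (n : nat) (K : fieldType).
Local Notation S := {mpoly K[n]}.
Implicit Types (f g h : S) (a b m : 'X_{1..n}) (I P Q : set S) (U V : {set 'I_n}).

Definition polyin U f : Prop := forall m, m \in msupp f -> forall i, i \notin U -> m i = 0%N.

(** Algebraic independence modulo [P] of the variables in [U]. *)
Definition indep P U : Prop := forall g, P g -> polyin U g -> g = 0.

Lemma polyin0 U : polyin U 0. Proof. by move=> m; rewrite msupp0. Qed.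
Lemma polyinD U f g : polyin U f -> polyin U g -> polyin U (f + g).
Proof. by move=> Uf Ug m /msuppD_le; rewrite mem_cat => /orP[/Uf|/Ug]. Qed.
Lemma polyinZ U c f : polyin U f -> polyin U (c *: f).
Proof. by move=> Uf m /msuppZ_le /Uf. Qed.
Lemma polyinM U f g : polyin U f -> polyin U g -> polyin U (f * g).
Proof.
move=> Uf Ug m /msuppM_le /allpairsP[[x y] /= [/Uf Ux /Ug Uy ->]] i iU.
by rewrite mnmDE Ux ?Uy.
Qed.
Lemma polyinX U m : (forall i, i \notin U -> m i = 0%N) -> polyin U 'X_[m].
Proof. by move=> Um m'; rewrite msuppX inE => /eqP->. Qed.
Lemma polyinS U V f : U \subset V -> polyin U f -> polyin V f.
Proof.
move=> /fintype.subsetP UV Uf m /Uf mU i iV; apply: mU.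
by apply: contra iV; apply: UV.
Qed.
Lemma polyin_sum U (T : Type) (r : seq T) (p : pred T) (F : T -> S) :
  (forall t, p t -> polyin U (F t)) -> polyin U (\sum_(t <- r | p t) F t).
Proof. by move=> UF; elim/big_ind: _ => //; [exact: polyin0|exact: polyinD]. Qed.

Definition del (i : 'I_n) m : 'X_{1..n} := [multinom if j == i then 0%N else m j | j < n].

Lemma delE i m j : del i m j = if j == i then 0%N else m j.
Proof. exact: mnmE. Qed.

Definition sep_var (i : 'I_n) (j : 'I_n) : {poly S} := if j == i then 'X else ('X_j)%:P.
(** Regards a polynomial as one in x_i; its coefficients are free of x_i but still typed in [S]. *)
Definition as_poly (i : 'I_n) : S -> {poly S} := mmap (polyC \o @mpolyC n K) (sep_var i).
HB.instance Definition _ i := GRing.RMorphism.on (as_poly i).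

Lemma as_polyX i m : as_poly i 'X_[m] = ('X_[del i m])%:P * 'X^(m i).
Proof.
rewrite /as_poly mmapX /mmap1 (bigD1 i) //= /sep_var eqxx mulrC; congr (_ * _).
rewrite [X in X%:P]mpolyXE_id [X in X%:P](bigD1 i) //= delE eqxx expr0 mul1r rmorph_prod /=.
by apply: eq_bigr => j /negbTE ji; rewrite ji delE ji rmorphXn.
Qed.

Lemma as_polyE i f k :
  (as_poly i f)`_k = \sum_(m <- msupp f) (f@_m * (m i == k)%:R) *: 'X_[del i m].
Proof.
rewrite [f in LHS]mpolyE rmorph_sum coef_sum; apply: eq_bigr => m _ /=.
rewrite -mul_mpolyC rmorphM /= [as_poly i _%:MP]mmapC /= as_polyX mulrA -rmorphM /=.
rewrite coefCM coefXn eq_sym mulr_natr mul_mpolyC -scalerA.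
by case: eqP; rewrite ?scale1r ?scale0r ?scaler0 ?mulr1n ?mulr0n.
Qed.

Lemma as_polyK i f : (as_poly i f).['X_i] = f.
Proof.
rewrite [f in LHS]mpolyE rmorph_sum horner_sum [RHS]mpolyE; apply: eq_bigr => m _ /=.
rewrite -mul_mpolyC rmorphM /= [as_poly i _%:MP]mmapC /= as_polyX.
rewrite !hornerM !hornerC hornerXn; congr (_ * _).
rewrite mpolyXn -mpolyXD; congr ('X_[_]); apply/mnmP => j.
rewrite mnmDE mulmnE mnm1E delE eq_sym; case: eqP => [->|_]; first by rewrite mul1n.
by rewrite addn0.
Qed.

Lemma polyin_coef i V f k : polyin V f -> polyin (V :\ i) (as_poly i f)`_k.
Proof.
move=> Vf; rewrite as_polyE big_seq; apply: polyin_sum => m /Vf mV; apply: polyinZ.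
apply: polyinX => j; rewrite delE !inE negb_and negbK; case: eqP => //= _; exact: mV.
Qed.

Lemma as_poly_id i V f : polyin V f -> i \notin V -> as_poly i f = f%:P.
Proof.
move=> Vf iV; apply/polyP => k; rewrite as_polyE coefC.
transitivity (\sum_(m <- msupp f) (0%N == k)%:R *: (f@_m *: 'X_[m])).
  apply: eq_big_seq => m /Vf mV; rewrite mV // scalerA [in RHS]mulrC; congr (_ *: 'X_[_]).
  by apply/mnmP => j; rewrite delE; case: eqP => // ->; rewrite mV.
rewrite -scaler_sumr -mpolyE eq_sym.
by case: eqP; rewrite ?scale1r ?scale0r.
Qed.

(** The extension to [S] of the contraction of [P] to the polynomials free of x_i. *)
Definition extend_var i P : set S := [set f | forall k, P (as_poly i f)`_k].

Lemma prime_extend_var i P : prime_ideal P -> prime_ideal (extend_var i P).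
Proof. by move=> hP; exact: (prime_preimage (as_poly i) (prime_poly hP)). Qed.

Lemma extend_varS i P : is_ideal P -> extend_var i P `<=` P.
Proof.
move=> hI f Pf; rewrite -(as_polyK i f) horner_coef.
by apply: ideal_sum => // k _; apply: idealMr.
Qed.

Lemma extend_var_in i V P f : is_ideal P -> polyin V f -> i \notin V -> P f ->
  extend_var i P f.
Proof.
move=> hI Vf iV Pf k; rewrite (as_poly_id Vf iV) coefC.
by case: eqP => // _; apply: ideal0.
Qed.

(** Each [j] in [s] gives a step from [extend_var j P] up to [P]: it is strict, since the relation
    of x_j over [U] has nonzero coefficients in the variables of [U], which are outside [P]. The
    relations of the other variables do not involve x_j and survive. *)
Lemma indep_chain U (s : seq 'I_n) P : prime_ideal P -> indep P U -> uniq s ->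
  (forall j, j \in s -> j \notin U) ->
  (forall j, j \in s -> exists h, [/\ h != 0, polyin (j |: U) h & P h]) ->
  prime_chain P (size s).
Proof.
elim: s P => [|j s IHs] P hP PU; first by move=> _ _ _; apply: prime_chain0.
move=> /= /andP[js us] sU sh; have hI := prime_is_ideal hP.
have jU : j \notin U by apply: sU; rewrite mem_head.
have hQ := prime_extend_var j hP; have QP := extend_varS (i := j) hI.
apply: (prime_chainS (P := extend_var j P)) => //.
  split=> // PQ; have [h [h0 Uh Ph]] := sh j (mem_head _ _).
  case/eqP: h0; rewrite -(as_polyK j h); suff -> : as_poly j h = 0 by rewrite horner0.
  have subU : (j |: U) :\ j \subset U.
    by apply/fintype.subsetP => i; rewrite !inE => /andP[/negbTE->].
  apply/polyP => k; rewrite coef0; apply: (PU _ (PQ h Ph k)).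
  exact: (polyinS subU (polyin_coef (i := j) (k := k) Uh)).
apply: IHs => //.
- by move=> g /QP; apply: PU.
- by move=> i is_; apply: sU; rewrite inE is_ orbT.
- move=> i is_; have [|h [h0 Uh Ph]] := sh i; first by rewrite inE is_ orbT.
  exists h; split=> //; apply: (extend_var_in hI Uh _ Ph).
  rewrite !inE negb_or jU andbT; by apply: contraNneq js => ->.
Qed.

Lemma indep0 P : prime_ideal P -> indep P finset.set0.
Proof.
move=> hP g Pg g0; have gE : g = (g@_0%MM)%:MP.
  apply/mpolyP => m; rewrite mcoeffC; case: eqP => [->|/eqP m0]; first by rewrite mulr1.
  rewrite mulr0; apply: memN_msupp_eq0; apply: contra m0 => /g0 m0.
  by apply/eqP/mnmP => i; rewrite mnm0E m0 // inE.
rewrite gE; case: (eqVneq g@_0%MM 0) => [->|c0]; first by rewrite mpolyC0.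
case: (prime_not1 hP); rewrite -mpolyC1 -(mulVf c0) rmorphM /= -gE.
by apply: idealMl; first exact: prime_is_ideal.
Qed.

(** When [U] has maximal size, each of the other n - |U| variables is algebraic over [U] modulo [P],
    and [indep_chain] applies to them. *)
Lemma max_indep_chain P : prime_ideal P -> exists U,
  [/\ indep P U, forall V, indep P V -> (#|V| <= #|U|)%N & prime_chain P (n - #|U|)].
Proof.
move=> hP; pose q k := `[< exists2 U, indep P U & #|U| = k >].
have exq : exists k, q k.
  by exists 0%N; apply/asboolP; exists finset.set0; [apply: indep0|rewrite cards0].
have ubq k : q k -> (k <= n)%N.
  by move=> /asboolP[U _ <-]; rewrite -[X in (_ <= X)%N]card_ord; apply: max_card.
case: (ex_maxnP exq ubq) => k /asboolP[U PU Uk] kmax.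
have Umax V : indep P V -> (#|V| <= #|U|)%N.
  by move=> PV; rewrite Uk kmax //; apply/asboolP; exists V.
exists U; split=> //.
have -> : (n - #|U|)%N = size (enum (~: U)).
  by rewrite -cardE [RHS]cardsCs finset.setCK card_ord.
apply: (indep_chain hP PU) => [|j|j]; first exact: enum_uniq.
  by rewrite mem_enum inE.
rewrite mem_enum inE => jU; apply: contrapT => nex.
suff /Umax : indep P (j |: U) by rewrite cardsU1 jU add1n ltnn.
by move=> g Pg Ug; apply: contrapT => /eqP g0; apply: nex; exists g.
Qed.

End Independence.

(** * Growth of residue rings *)

Section Growth.
Variables (n : nat) (K : fieldType).
Local Notation S := {mpoly K[n]}.
Implicit Types (f g h : S) (a b m : 'X_{1..n}) (I P Q : set S) (U V : {set 'I_n}).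

Definition free_mod (T : finType) P (b : T -> S) : Prop :=
  forall c : T -> K, P (\sum_t c t *: b t) -> forall t, c t = 0.

(** With more elements than monomials, the coefficient matrix of the representatives has a nonzero
    left kernel vector, which is a relation modulo [I]. *)
Lemma free_mod_card (T : finType) I (b : T -> S) (M : seq 'X_{1..n}) : is_ideal I ->
  free_mod I b -> (forall t, exists q, I (b t - q) /\ {subset msupp q <= M}) ->
  (#|T| <= size M)%N.
Proof.
move=> hI bI /choice[q Hq]; rewrite leqNgt; apply/negP => ltM.
pose A : 'M[K]_(#|T|, size M) := \matrix_(i, j) (q (enum_val i))@_(nth 0%MM M j).
have /rowV0Pn[v /sub_kermxP vA] : kermx A != 0.
  rewrite -mxrank_eq0 mxrank_ker subn_eq0 -ltnNge.
  exact: leq_ltn_trans (rank_leq_col _) ltM.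
case/eqP; apply/rowP => i; rewrite mxE.
have := bI (fun t => v 0 (enum_rank t)) _ (enum_val i); rewrite enum_valK; apply.
have -> : \sum_t v 0 (enum_rank t) *: b t = \sum_t v 0 (enum_rank t) *: (b t - q t).
  under [RHS]eq_bigr do rewrite scalerBr; rewrite sumrB.
  suff -> : \sum_t v 0 (enum_rank t) *: q t = 0 by rewrite subr0.
  apply/mpolyP => m; rewrite mcoeff0 raddf_sum /=.
  under eq_bigr do rewrite mcoeffZ.
  case: (boolP (m \in M)) => mM; last first.
    rewrite big1 // => t _; rewrite [_@_m]memN_msupp_eq0 ?mulr0 //.
    by apply: contra mM; have [_] := Hq t; apply.
  have im : (index m M < size M)%N by rewrite index_mem.
  have := congr1 (fun w : 'rV_(size M) => w 0 (Ordinal im)) vA; rewrite !mxE => e.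
  rewrite (reindex (@enum_val T predT)) /=; last first.
    by exists enum_rank => t _; [exact: enum_valK|exact: enum_rankK].
  rewrite -[RHS]e; apply: eq_bigr => j _.
  by rewrite mxE /= nth_index // enum_valK.
apply: ideal_sum => // t _; rewrite -mul_mpolyC; apply: idealMl => //.
by have [] := Hq t.
Qed.

Definition box_mono U B (t : {ffun {i | i \in U} -> 'I_B}) : 'X_{1..n} :=
  [multinom if insub i is Some u then (t u : nat) else 0%N | i < n].

Lemma box_mono_in U B t (u : {i | i \in U}) : @box_mono U B t (val u) = t u.
Proof. by rewrite mnmE valK. Qed.

Lemma box_mono_notin U B t i : i \notin U -> @box_mono U B t i = 0%N.
Proof. by move=> iU; rewrite mnmE insubN. Qed.

Lemma box_mono_lt U B t i : (0 < B)%N -> (@box_mono U B t i < B)%N.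
Proof. by move=> B0; rewrite mnmE; case: insub. Qed.

Lemma box_mono_inj U B : injective (@box_mono U B).
Proof.
by move=> s t st; apply/ffunP => u; apply: val_inj; rewrite /= -!box_mono_in st.
Qed.

Lemma card_box U B : #|{ffun {i | i \in U} -> 'I_B}| = (B ^ #|U|)%N.
Proof. by rewrite card_ffun card_ord card_sig. Qed.

Definition box U B : seq 'X_{1..n} := [seq @box_mono U B t | t in predT].

Lemma size_box U B : size (box U B) = (B ^ #|U|)%N.
Proof. by rewrite size_map -cardE card_box. Qed.

Lemma mem_box U B m : (forall i, i \notin U -> m i = 0%N) -> (forall i, (m i < B)%N) ->
  m \in box U B.
Proof.
move=> mU mB; apply/mapP; exists [ffun u => Ordinal (mB (val u))]; first by rewrite mem_enum.
apply/mnmP => i; case: (boolP (i \in U)) => iU; last by rewrite box_mono_notin ?mU.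
by rewrite -[i]/(val (Sub i iU : {i | i \in U})) box_mono_in ffunE.
Qed.

Lemma indep_free P U B : indep P U -> free_mod P (fun t => 'X_[@box_mono U B t]).
Proof.
move=> PU c Pc t; set g := \sum_t _ in Pc.
have g0 : g = 0.
  apply: PU => //; apply: polyin_sum => s _; apply/polyinZ/polyinX => i.
  exact: box_mono_notin.
have := congr1 (fun h => h@_(box_mono t)) g0; rewrite mcoeff0 /g raddf_sum (bigD1 t) //=.
rewrite mcoeffZ mcoeffX eqxx mulr1 big1 ?addr0 // => s st.
by rewrite mcoeffZ mcoeffX (inj_eq (@box_mono_inj U B)) (negbTE st) mulr0.
Qed.

(** A lower bound r for the Hilbert function of S/P in degrees at most d, without quotients; [msize]
    is the degree plus one. *)
Definition rich P (d r : nat) : Prop := exists (T : finType) (b : T -> S),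
  [/\ #|T| = r, free_mod P b & forall t, (msize (b t) <= d.+1)%N].

Lemma rich0 P d : rich P d 0.
Proof. by exists void, (fun=> 0); split=> [|c _ []|[]]; rewrite ?card_void. Qed.

(* If g lies in Q but not in P then S/P contains S/Q and g * S/P independently. *)
Lemma rich_step P Q g d r d' s D : prime_ideal P -> is_ideal Q -> P `<=` Q -> Q g -> ~ P g ->
  rich Q d r -> rich P d' s -> (d <= D)%N -> ((msize g).+1 + d' <= D)%N -> rich P D (r + s).
Proof.
move=> hP hQ PQ Qg nPg [T [b [<- bQ bd]]] [T' [b' [<- bP b'd]]] dD d'D.
exists (T + T')%type, (fun t => match t with inl t => b t | inr t => g * b' t end).
split=> [|c Pc|]; first by rewrite card_sum.
- rewrite big_sumType /= in Pc.
  have gE : \sum_t c (inr t) *: (g * b' t) = g * \sum_t c (inr t) *: b' t.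
    by rewrite mulr_sumr; apply: eq_bigr => t _; rewrite scalerAr.
  rewrite gE in Pc.
  have c1 := bQ (c \o inl) (idealDr hQ (idealMr _ hQ Qg) (PQ _ Pc)).
  rewrite big1 ?add0r in Pc; last by move=> t _; have /= -> := c1 t; rewrite scale0r.
  have c2 : P (\sum_t c (inr t) *: b' t) by case/(primeM hP): Pc.
  by case=> t; [exact: c1|exact: (bP (c \o inr))].
- case=> t; first by apply: leq_trans (bd t) _; rewrite ltnS.
  apply: leq_trans (msizeM_le _ _) _; rewrite ltnS.
  by apply: leq_trans d'D; rewrite addSnnS leq_add2l.
Qed.

Definition growth P (u : nat) : Prop :=
  exists C, forall N, (0 < N)%N -> rich P (C * N) (N ^ u).

(** Iterating [rich_step] N times stacks N families of N^u elements, and the degrees stay linear in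
    N. *)
Lemma growthS P Q u : prime_ideal P -> is_ideal Q -> P `<` Q -> growth Q u -> growth P u.+1.
Proof.
move=> hP hQ [PQ QP] [C Cg].
have [g [Qg nPg]] : exists g, Q g /\ ~ P g.
  by apply: contrapT => nex; apply: QP => g Qg; apply: contrapT => nPg; apply: nex; exists g.
pose e := (msize g).+1; exists (C + e)%N => N N0.
suff H k : rich P (C * N + e * k) (N ^ u * k) by have := H N; rewrite -mulnDl expnSr.
elim: k => [|k IHk]; first by rewrite !muln0; apply: rich0.
rewrite [X in rich _ _ X]mulnS.
apply: (rich_step hP hQ PQ Qg nPg (Cg N N0) IHk); first exact: leq_addr.
by rewrite mulnS addnCA.
Qed.

Lemma indep_growth P U : indep P U -> growth P #|U|.
Proof.
move=> PU; exists n => N N0.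
exists {ffun {i | i \in U} -> 'I_N}, (fun t => 'X_[@box_mono U N t]).
split; [exact: card_box|exact: indep_free|] => t; rewrite msizeX ltnS mdegE.
apply: (@leq_trans (\sum_(i < n) N)%N); last by rewrite sum_nat_const card_ord.
by apply: leq_sum => i _; apply/ltnW/box_mono_lt.
Qed.

Lemma growth_le P u : is_ideal P -> growth P u -> (u <= n)%N.
Proof.
move=> hP [C Cg]; rewrite leqNgt; apply/negP => nu.
(* Chosen so that (C N + 1)^n <= (C + 1)^n N^n < N^(n+1). *)
pose N := (C.+1 ^ n).+1; have [//|T [b [Tr bP bd]]] := Cg N.
have := @free_mod_card T P b (box [set: 'I_n] (C * N).+1) hP bP.
rewrite Tr size_box cardsT card_ord => le.
have : (N ^ u <= (C * N).+1 ^ n)%N.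
  apply: le => t; exists (b t); split; first by rewrite subrr; apply: ideal0.
  move=> m mb; apply: mem_box => i; rewrite ?inE //.
  have := leq_trans (msize_mdeg_lt mb) (bd t); rewrite !ltnS; apply: leq_trans.
  by rewrite mdegE (bigD1 i) //= leq_addr.
apply/negP; rewrite -ltnNge; apply: (@leq_trans (N ^ n.+1)); last by rewrite leq_pexp2l.
rewrite expnSr; apply: (@leq_ltn_trans ((C.+1 * N) ^ n)).
  have CN : ((C * N).+1 <= C.+1 * N)%N by rewrite mulSn -add1n leq_add2r.
  by elim: (n) => // k IHk; rewrite !expnS leq_mul.
by rewrite expnMn mulnC ltn_pmul2l ?expn_gt0.
Qed.

(** Descending the chain from [P], where the growth exponent is |U|, each strict inclusion adds one
    to it, and it never exceeds n. *)
Lemma prime_chain_card P U k : prime_ideal P -> indep P U -> prime_chain P k ->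
  (k + #|U| <= n)%N.
Proof.
move=> hP /indep_growth PU [Q [Qprime Qlt Qk]].
have gr j : (j <= k)%N -> growth (Q (k - j)%N) (j + #|U|).
  elim: j => [|j IHj] jk; first by rewrite subn0 Qk.
  have e : (k - j)%N = (k - j.+1).+1 by lia.
  apply: (growthS (Q := Q (k - j)%N)); last exact/IHj/ltnW.
  - exact/Qprime/leq_subr.
  - exact/prime_is_ideal/Qprime/leq_subr.
  - by rewrite e; apply: Qlt; lia.
have := gr k (leqnn _); apply: growth_le.
by apply/prime_is_ideal/Qprime; rewrite leq_subr.
Qed.

End Growth.

(** * Weights refining a term order *)

Section Weights.

Lemma separate_point (l : rat) (R : seq rat) : (forall r, r \in R -> l < r) ->
  exists2 x, l < x & forall r, r \in R -> x < r.
Proof.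
elim: R => [|r R IHR] lR; first by exists (l + 1) => //; rewrite ltrDl.
have [x lx xR] := IHR (fun s sR => lR s (@mem_behead _ (r :: R) s sR)).
have lr := lR r (mem_head _ _).
exists (Num.min x ((l + r) / 2)); first by rewrite lt_min lx; lra.
move=> s /predU1P[->|/xR xs]; rewrite gt_min; [apply/orP; right; lra|by rewrite xs].
Qed.

Lemma separate_seq (L R : seq rat) : (forall l r, l \in L -> r \in R -> l < r) ->
  exists x, (forall l, l \in L -> l < x) /\ forall r, r \in R -> x < r.
Proof.
elim: L => [|l L IHL] LR.
  exists (- (1 + \sum_(r <- R) `|r|)); split=> // r rR.
  have : `|r| <= \sum_(r <- R) `|r|.
    by rewrite (big_rem r) //= lerDl sumr_ge0.
  by have := ler_norm (- r); rewrite normrN; lra.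
have [x [xL xR]] := IHL (fun k r kL => LR k r (@mem_behead _ (l :: L) k kL)).
have [y ly yR] := separate_point (fun r => LR l r (mem_head _ _)).
exists (Num.max x y); split=> [k|r rR]; last by rewrite gt_max xR ?yR.
by case/predU1P => [->|/xL kx]; rewrite lt_max ?ly ?kx ?orbT.
Qed.

Variables (n : nat) (ord : rel 'X_{1..n}).
Hypothesis hord : term_order ord.
Local Notation pair := ('X_{1..n} * 'X_{1..n})%type.
Implicit Types (v : pair) (w : 'I_n -> rat).

(** A pair encodes the requirement that [v.1] weigh more than [v.2]; [gap v] is the vector of this
    linear inequality. *)
Definition gap v i : rat := (v.1 i)%:R - (v.2 i)%:R.
Definition wgap w v : rat := \sum_i w i * gap v i.

(* Fourier-Motzkin elimination: [combine] is positive and does not involve i. *)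
Definition combine i v v' : pair :=
  ((v.1 *+ (v'.2 i - v'.1 i) + v'.1 *+ (v.1 i - v.2 i))%MM,
   (v.2 *+ (v'.2 i - v'.1 i) + v'.2 *+ (v.1 i - v.2 i))%MM).

Lemma gap_combine i v v' j : (v.2 i < v.1 i)%N -> (v'.1 i < v'.2 i)%N ->
  gap (combine i v v') j = - gap v' i * gap v j + gap v i * gap v' j.
Proof.
move=> vi v'i; rewrite /gap /= !mnmDE !mulmnE !natrD !natrM !natrB ?(ltnW vi) ?(ltnW v'i) //.
by ring.
Qed.

Lemma tlt_combine i v v' : (v.2 i < v.1 i)%N -> (v'.1 i < v'.2 i)%N ->
  tlt ord v.2 v.1 -> tlt ord v'.2 v'.1 -> tlt ord (combine i v v').2 (combine i v v').1.
Proof.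
move=> vi v'i lt lt'.
by apply: tlt_add => //; [apply/tltW|]; apply: tlt_muln; rewrite ?subn_gt0.
Qed.

(** Induction on the number of coordinates in which pairs may differ. Combined pairs still increase
    for the term order, so the elimination cannot end in an inconsistency: that would be a pair with
    equal members, which [tlt] excludes. *)
Lemma weight_elim k (V : seq pair) : (k <= n)%N ->
  (forall v, v \in V -> tlt ord v.2 v.1) ->
  (forall v, v \in V -> forall i : 'I_n, (k <= i)%N -> v.1 i = v.2 i) ->
  exists w, forall v, v \in V -> 0 < wgap w v.
Proof.
elim: k V => [|k IHk] V kn Vlt Veq.
  exists (fun=> 0) => v vV; have := Vlt v vV.
  have -> : v.1 = v.2 by apply/mnmP => i; apply: Veq.
  by rewrite tltxx.
pose i0 := Ordinal kn.
pose VP := [seq v : pair <- V | (v.2 i0 < v.1 i0)%N].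
pose VN := [seq v : pair <- V | (v.1 i0 < v.2 i0)%N].
pose VZ := [seq v : pair <- V | v.1 i0 == v.2 i0].
pose V' := VZ ++ [seq combine i0 v v' | v <- VP, v' <- VN].
have [||w wV'] := IHk V' (ltnW kn).
- move=> v; rewrite mem_cat => /orP[|/allpairsP[[u u'] /= [uP uN ->]]].
    by rewrite mem_filter => /andP[_ /Vlt].
  move: uP uN; rewrite !mem_filter => /andP[u0 /Vlt ult] /andP[u0' /Vlt ult'].
  exact: tlt_combine.
- move=> v vV' i; rewrite leq_eqVlt => /predU1P[ki|ki].
    have <- : i0 = i by apply: val_inj.
    move: vV'; rewrite mem_cat => /orP[|/allpairsP[[u u'] /= [uP uN ->]] /=].
      by rewrite mem_filter => /andP[/eqP].
    move: uP uN; rewrite !mem_filter => /andP[u0 _] /andP[u0' _].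
    by rewrite !mnmDE !mulmnE !mulnBr mulnC; nia.
  move: vV'; rewrite mem_cat => /orP[|/allpairsP[[u u'] /= [uP uN ->]] /=].
    by rewrite mem_filter => /andP[_ /Veq]; apply.
  move: uP uN; rewrite !mem_filter => /andP[_ /Veq e] /andP[_ /Veq e'].
  by rewrite !mnmDE !mulmnE (e i ki) (e' i ki).
pose r v := \sum_(i | i != i0) w i * gap v i.
have wgapE x v : wgap (fun i => if i == i0 then x else w i) v = x * gap v i0 + r v.
  rewrite /wgap (bigD1 i0) //= eqxx; congr (_ + _).
  by apply: eq_bigr => i /negbTE->.
have wE v : wgap w v = w i0 * gap v i0 + r v by rewrite /wgap (bigD1 i0).
have gapP v : (v.2 i0 < v.1 i0)%N -> 0 < gap v i0 by rewrite subr_gt0 ltr_nat.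
have gapN v : (v.1 i0 < v.2 i0)%N -> gap v i0 < 0 by rewrite subr_lt0 ltr_nat.
(* The new weight of [i0] has lower bounds from [VP] and upper bounds from [VN]; the combined pairs
   make them compatible. *)
have [|x [xP xN]] := @separate_seq [seq - r v / gap v i0 | v <- VP]
                                   [seq - r v / gap v i0 | v <- VN].
  move=> _ _ /mapP[v vP ->] /mapP[v' vN ->].
  have : combine i0 v v' \in V' by rewrite mem_cat (allpairs_f (combine i0) vP vN) orbT.
  move/wV'; move: vP vN; rewrite !mem_filter => /andP[v0 _] /andP[v0' _].
  have -> : wgap w (combine i0 v v') = - gap v' i0 * r v + gap v i0 * r v'.
    rewrite wE gap_combine //.
    have -> : r (combine i0 v v') = - gap v' i0 * r v + gap v i0 * r v'.
      rewrite /r !mulr_sumr -big_split /=; apply: eq_bigr => i _.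
      by rewrite gap_combine //; ring.
    by ring.
  move: (gapP v v0) (gapN v' v0') => gp gn.
  rewrite ltr_pdivrMr // mulrAC ltr_ndivlMr // => pos.
  by lra.
exists (fun i => if i == i0 then x else w i) => v vV; rewrite wgapE.
case: (ltngtP (v.1 i0) (v.2 i0)) => v0.
- have /xN : - r v / gap v i0 \in [seq - r v / gap v i0 | v <- VN].
    by apply: (map_f (fun v => - r v / gap v i0)); rewrite mem_filter v0.
  by rewrite ltr_ndivlMr ?gapN // -subr_gt0 opprK.
- have /xP : - r v / gap v i0 \in [seq - r v / gap v i0 | v <- VP].
    by apply: (map_f (fun v => - r v / gap v i0)); rewrite mem_filter v0.
  by rewrite ltr_pdivrMr ?gapP // -subr_gt0 opprK.
- have vZ : v \in V' by rewrite mem_cat mem_filter v0 eqxx vV.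
  have := wV' v vZ; rewrite wE.
  by have -> : gap v i0 = 0; rewrite ?mulr0 // /gap v0 subrr.
Qed.

Definition wt w (m : 'X_{1..n}) : rat := \sum_i w i * (m i)%:R.

Lemma wtD w a b : wt w (a + b)%MM = wt w a + wt w b.
Proof.
rewrite /wt -big_split /=; apply: eq_bigr => i _.
by rewrite mnmDE natrD mulrDr.
Qed.

(** Adding the pairs (x_i, 1) forces the weights to be positive. *)
Lemma weight_exists (V : seq pair) : (forall v, v \in V -> tlt ord v.2 v.1) ->
  exists w, (forall i, 0 < w i) /\ forall v, v \in V -> wt w v.2 < wt w v.1.
Proof.
move=> Vlt; have [|||w wV] := @weight_elim n (V ++ [seq (U_(i)%MM, 0%MM) | i <- enum 'I_n]).
- exact: leqnn.
- move=> v; rewrite mem_cat => /orP[/Vlt//|/mapP[i _ ->]] /=.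
  by rewrite /tlt (term_order_ge0 hord) /= eq_sym mnm1_eq0.
- by move=> v _ i; rewrite leqNgt ltn_ord.
have wgE v : wgap w v = wt w v.1 - wt w v.2.
  by rewrite /wt -sumrB; apply: eq_bigr => i _; rewrite mulrBr.
exists w; split=> [i|v vV]; last by rewrite -subr_gt0 -wgE; apply: wV; rewrite mem_cat vV.
have : (U_(i)%MM, 0%MM) \in V ++ [seq (U_(i)%MM, 0%MM : 'X_{1..n}) | i <- enum 'I_n].
  by rewrite mem_cat map_f ?orbT // mem_enum.
move/wV; rewrite wgE /wt /= (bigD1 i) //= big1 => [|j ji].
  rewrite big1 => [|j _]; last by rewrite mnm0E mulr0.
  by rewrite mnm1E eqxx mulr1 addr0 subr0.
by rewrite mnm1E eq_sym (negbTE ji) mulr0.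
Qed.

End Weights.

(** * Standard monomials *)

Section StandardMonomials.
Variables (n : nat) (K : fieldType) (ord : rel 'X_{1..n}).
Hypothesis hord : term_order ord.
Local Notation S := {mpoly K[n]}.
Implicit Types (f g h : S) (a b m : 'X_{1..n}) (U V : {set 'I_n}).
Local Notation inM := (inM ord).
Local Notation lead := (initial_monomial ord).

Variable I : set S.
Hypothesis hI : is_ideal I.
Hypothesis I_rad : forall a, inM I a -> inM I (indic (msetsupp a)).

Lemma indic_msetsupp_le a : (indic (msetsupp a) <= a)%MM.
Proof. by apply/mnm_lepP => i; rewrite mnmE inE; case: (a i). Qed.

(* A weight refining the order on a finite Groebner basis bounds the normal forms. *)
Lemma weighted_normal_form : exists w : 'I_n -> rat, (forall i, 0 < w i) /\
  forall f (D : rat), (forall m, m \in msupp f -> wt w m <= D) ->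
  exists q, I (f - q) /\ forall m, m \in msupp q -> ~ inM I m /\ wt w m <= D.
Proof.
have /choice[G HG] : forall B : {set 'I_n}, exists g,
    inM I (indic B) -> I g /\ lead g (indic B).
  move=> B; case: (pselect (inM I (indic B))) => [[g Ig lg]|nB]; first by exists g.
  by exists 0.
(* By radicality the [G B] for [B] in [GB] form a finite Groebner basis; [V] asks that each leading
   monomial outweigh the other monomials. *)
pose GB := [seq B <- enum {: {set 'I_n}} | `[< inM I (indic B) >]].
pose V := flatten [seq [seq (indic B, m) | m <- msupp (G B) & m != indic B] | B <- GB].
have [v|w [w0 wV]] := weight_exists hord (V := V).
  case/flatten_mapP => B; rewrite mem_filter => /andP[/asboolP IB _] /mapP[m].
  rewrite mem_filter => /andP[mB mG] -> /=; rewrite /tlt mB andbT.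
  by have [_ [_ ub]] := HG B IB; apply: ub.
exists w; split=> // f D; elim/(@bound_ind n K ord hord): f => [|f a la IHf] fD.
  by exists 0; split=> [|m]; rewrite ?msupp0 // subrr; apply: ideal0.
have af : a \in msupp f by case: la.
case: (pselect (inM I a)) => [Ia|nIa].
  set B := msetsupp a; have [Ig lg] := HG B (I_rad Ia).
  have Ba : (indic B <= a)%MM := indic_msetsupp_le a.
  set c := f@_a / (G B)@_(indic B); pose q := c *: 'X_[a - indic B] * G B.
  have Iq : I q by exact: idealMl.
  have [||r [Ir rD]] := IHf (f - q).
  - exact: sbnd_reduce.
  - move=> m /msuppB_le; rewrite mem_cat => /orP[/fD//|].
    case/msuppM_le/allpairsP => -[x y] /= [/msuppZ_le + yG ->].
    rewrite msuppX inE => /eqP->; apply: le_trans (fD a af).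
    rewrite -[X in _ <= wt w X](submK Ba) !wtD lerD2l.
    case: (eqVneq y (indic B)) => [->//|yB]; apply/ltW.
    apply: (wV (indic B, y)); apply/flatten_mapP; exists B.
      by rewrite mem_filter mem_enum andbT; apply/asboolP/I_rad.
    by apply: map_f; rewrite mem_filter yB.
  exists r; split=> //.
  have -> : f - r = (f - q - r) + q by ring.
  exact: idealD.
have [||r [Ir rD]] := IHf (f - f@_a *: 'X_[a]).
- apply: lead_cancel; [exact: lead_ubnd|exact/ubndZ/ubndX|].
  by rewrite mcoeffZ mcoeffX eqxx mulr1.
- move=> m /msuppB_le; rewrite mem_cat => /orP[/fD//|/msuppZ_le].
  by rewrite msuppX inE => /eqP->; apply: fD.
exists (r + f@_a *: 'X_[a]); split.
  by have -> : f - (r + f@_a *: 'X_[a]) = f - f@_a *: 'X_[a] - r by ring.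
move=> m /msuppD_le; rewrite mem_cat => /orP[/rD//|/msuppZ_le].
by rewrite msuppX inE => /eqP->; split=> //; apply: fD.
Qed.

(** Otherwise standard monomials have supports smaller than |U|, so those of weight O(N) number
    O(N^(|U|-1)); yet they span, modulo [I], the N^|U| independent box monomials in [U]. *)
Lemma initial_indep U : indep I U -> exists V, ~ inM I (indic V) /\ (#|U| <= #|V|)%N.
Proof.
move=> IU; apply: contrapT => nex.
have small V : ~ inM I (indic V) -> (#|V| < #|U|)%N.
  by move=> nV; rewrite ltnNge; apply/negP => UV; apply: nex; exists V.
have [w [w0 nf]] := weighted_normal_form.
pose W : rat := \sum_i w i.
have W0 : 0 <= W by apply: sumr_ge0 => i _; apply/ltW.
(* Box monomials weigh at most W N, so the exponents in their normal forms are at most W N / w_i <=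
   (C + 1) N. *)
pose C := \max_i (Num.truncn (W / w i)).+1.
have CP i : W / w i < C.+1%:R.
  apply: (lt_le_trans (truncnS_gt _)); rewrite ler_nat ltnW // ltnS.
  exact: (leq_bigmax (F := fun i => (Num.truncn (W / w i)).+1)).
(* Chosen so that 2^n (C + 2)^|U| < N, which contradicts the final count. *)
pose N := (2 ^ n * C.+2 ^ #|U|).+1.
pose std := [seq V <- enum {: {set 'I_n}} | `[< ~ inM I (indic V) >]].
pose M := flatten [seq box V (C.+1 * N).+1 | V <- std].
(* The extra factor on the left avoids the exponent |U| - 1. *)
have sizeM : (size M * (C.+1 * N).+1 <= 2 ^ n * (C.+1 * N).+1 ^ #|U|)%N.
  have -> : (2 ^ n)%N = size (enum {: {set 'I_n}}).
    by rewrite -cardE -cardsT -powersetT card_powerset cardsT card_ord.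
  have stdP V : V \in std -> (#|V| < #|U|)%N.
    by rewrite mem_filter => /andP[/asboolP/small].
  have : (size std <= size (enum {: {set 'I_n}}))%N by rewrite size_filter count_size.
  move=> le; apply: (@leq_trans (size std * (C.+1 * N).+1 ^ #|U|)); last first.
    by rewrite leq_mul2r le orbT.
  rewrite /M; elim: (std) stdP => [|V s IHs] sP; first by rewrite !mul0n.
  rewrite /= size_cat size_box mulnDl mulSn; apply: leq_add.
    by rewrite -expnSr leq_exp2l // sP // mem_head.
  by apply: IHs => V' V's; apply: sP; rewrite inE V's orbT.
have := free_mod_card (M := M) hI (indep_free (B := N) IU).
rewrite card_box => le.
have {}le : (N ^ #|U| <= size M)%N.
  apply: le => t.
  have [m|q [Iq qM]] := nf 'X_[box_mono t] (W * N%:R).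
    rewrite msuppX inE => /eqP->; rewrite /wt /W mulr_suml; apply: ler_sum => i _.
    by rewrite ler_pM2l // ler_nat; apply/ltnW/box_mono_lt.
  exists q; split=> // m /qM[nIm wm]; apply/flatten_mapP; exists (msetsupp m).
    rewrite mem_filter mem_enum andbT; apply/asboolP => h; apply: nIm.
    exact: (inM_up hord hI h (indic_msetsupp_le m)).
  refine (mem_box _ _) => i; first by rewrite inE negbK => /eqP.
  have wi : w i * (m i)%:R <= W * N%:R.
    apply: le_trans wm; rewrite /wt (bigD1 i) //= lerDl sumr_ge0 // => j _.
    by rewrite mulr_ge0 ?ler0n // ltW.
  rewrite ltnS -(ler_nat rat) natrM.
  have : (m i)%:R <= (W / w i) * N%:R by rewrite mulrAC ler_pdivlMr // mulrC.
  move/le_trans; apply; rewrite ler_wpM2r ?ler0n //; exact/ltW.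
have {sizeM} : (N ^ #|U| * (C.+1 * N).+1 <= 2 ^ n * (C.+1 * N).+1 ^ #|U|)%N.
  by apply: leq_trans sizeM; rewrite leq_mul2r le orbT.
apply/negP; rewrite -ltnNge.
have CN : ((C.+1 * N).+1 <= C.+2 * N)%N by rewrite [in X in (_ <= X)%N]mulSn -add1n leq_add2r.
apply: (@leq_ltn_trans (2 ^ n * (C.+2 * N) ^ #|U|)).
  by rewrite leq_mul2l; apply/orP; right; elim: #|U| => // k IHk; rewrite !expnS leq_mul.
rewrite expnMn mulnA [X in (_ < X)%N]mulnC ltn_pmul2r ?expn_gt0 //.
by rewrite ltnS mulSn; apply: leq_trans (leq_addr _ _); rewrite /N leqnSn.
Qed.

End StandardMonomials.

(** * Heights *)

Section ExtendedNat.
Implicit Types (A : set enat) (x y : enat).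

Lemma le_esup A x : A x -> (x <= esup A)%O.
Proof.
move=> Ax; rewrite /esup /supremum; case: ifPn => [/eqP A0|_]; first by rewrite A0 in Ax.
case: xgetP => [_ -> [ub _]|nex]; first exact: ub.
by have [z /nex] := enat_supremums_neq0 A.
Qed.

Lemma esup_le A y : (forall x, A x -> (x <= y)%O) -> (esup A <= y)%O.
Proof.
move=> Ay; rewrite /esup /supremum; case: ifPn => [_|_]; first by case: y {Ay}.
case: xgetP => [_ -> [_ lb]|nex]; first exact: lb.
by have [z /nex] := enat_supremums_neq0 A.
Qed.

Lemma einf_le A x : A x -> (einf A <= x)%O.
Proof.
move=> Ax; rewrite /einf /infimum; case: ifPn => [/eqP A0|_]; first by rewrite A0 in Ax.
case: xgetP => [_ -> [lb _]|nex]; first exact: lb.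
by have [z /nex] := enat_infimums_neq0 A.
Qed.

Lemma le_einf A y : (forall x, A x -> (y <= x)%O) -> (y <= einf A)%O.
Proof.
move=> Ay; rewrite /einf /infimum; case: ifPn => [_|_]; first by case: y {Ay}.
case: xgetP => [_ -> [_ ub]|nex]; first exact: ub.
by have [z /nex] := enat_infimums_neq0 A.
Qed.

Lemma einf_finite A k : (einf A <= (Some k : enat))%O -> exists2 j, A (Some j) & (j <= k)%N.
Proof.
move=> Ak; apply: contrapT => nex.
have : ((Some k.+1 : enat) <= einf A)%O.
  apply: le_einf => -[j Aj|_ //]; rewrite /Order.le /= ltnNge; apply/negP => jk.
  by apply: nex; exists j.
by move/le_trans/(_ Ak); rewrite /Order.le /= ltnn.
Qed.

Lemma esucc_le x y : (x <= y)%O -> (esucc x <= esucc y)%O.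
Proof. by case: x y => [a|] [b|]. Qed.

End ExtendedNat.

Section Heights.
Variable R : comNzRingType.
Implicit Types (I J P Q : set R).

Lemma prime_height_ge P k : prime_chain P k -> ((Some k : enat) <= prime_height P)%O.
Proof. by move=> Pk; apply: le_esup; exists k. Qed.

Lemma prime_height_le P k : (forall j, prime_chain P j -> (j <= k)%N) ->
  (prime_height P <= (Some k : enat))%O.
Proof. by move=> Pk; apply: esup_le => _ [j /Pk jk <-]. Qed.

Lemma height_le J P : prime_ideal P -> J `<=` P -> (height J <= prime_height P)%O.
Proof. by move=> hP JP; apply: einf_le; exists P. Qed.

Lemma le_height J x : (forall P, prime_ideal P -> J `<=` P -> (x <= prime_height P)%O) ->
  (x <= height J)%O.
Proof. by move=> Jx; apply: le_einf => _ [P [hP JP] <-]; apply: Jx. Qed.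

Lemma heightS I J : I `<=` J -> (height I <= height J)%O.
Proof.
by move=> IJ; apply: le_height => P hP JP; apply: height_le => // x /IJ/JP.
Qed.

Lemma prime_heightS P Q : prime_ideal Q -> P `<=` Q -> (prime_height P <= prime_height Q)%O.
Proof.
move=> hQ PQ; apply: esup_le => _ [k Pk <-].
case: (pselect (Q `<=` P)) => QP.
  by apply: prime_height_ge; have <- : P = Q by apply/seteqP.
apply: (le_trans (y := Some k.+1 : enat)); first exact: leqnSn.
by apply: prime_height_ge; apply: prime_chainS Pk.
Qed.

Lemma prime_height_lt P Q : prime_ideal P -> prime_ideal Q -> P `<` Q ->
  (esucc (prime_height P) <= prime_height Q)%O.
Proof.
move=> hP hQ PQ; have chainS k : prime_chain P k -> ((Some k.+1 : enat) <= prime_height Q)%O.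
  by move=> Pk; apply: prime_height_ge; apply: prime_chainS Pk.
case: (prime_height Q) chainS => [[|y]|] chainS; last by case: (esucc _).
  by have := chainS 0%N (prime_chain0 hP).
have : (prime_height P <= (Some y : enat))%O.
  by apply: esup_le => _ [k /chainS Pk <-].
exact: esucc_le.
Qed.

Lemma minimal_prime_eq J P Q : minimal_prime J P -> prime_ideal Q -> J `<=` Q ->
  Q `<=` P -> Q = P.
Proof. by case=> _ _; apply. Qed.

End Heights.

Section VariableIdeal.
Variables (n : nat) (K : fieldType) (V : {set 'I_n}).
Local Notation S := {mpoly K[n]}.

(* The prime generated by the variables outside V. *)
Definition var_ideal : set S :=
  mono_ideal [set m : 'X_{1..n} | exists2 i, i \notin V & m i != 0%N].

(** Setting the variables outside [V] to 0 is a ring morphism with kernel [var_ideal], whence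
    primality. *)
Definition kill_var (i : 'I_n) : S := if i \in V then 'X_i else 0.
Definition kill_vars : S -> S := mmap (@mpolyC n K) kill_var.
HB.instance Definition _ := GRing.RMorphism.on kill_vars.

Lemma kill_varsX (m : 'X_{1..n}) :
  kill_vars 'X_[m] = if [forall i, (i \notin V) ==> (m i == 0%N)] then 'X_[m] else 0.
Proof.
rewrite /kill_vars mmapX /mmap1; case: ifPn => [/forallP mV|].
  rewrite [RHS]mpolyXE_id; apply: eq_bigr => i _; rewrite /kill_var.
  by have := mV i; case: (i \in V) => //= /eqP->.
case/forallPn => i; rewrite negb_imply => /andP[iV mi].
by rewrite (bigD1 i) //= /kill_var (negbTE iV) expr0n (negbTE mi) mul0r.
Qed.

Lemma var_idealE : var_ideal = [set f | kill_vars f = 0].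
Proof.
apply/seteqP; split=> f.
  move=> Vf; rewrite /= [f]mpolyE rmorph_sum big_seq big1 // => m /Vf[i iV mi] /=.
  rewrite -mul_mpolyC rmorphM /= kill_varsX; case: ifP => [/forallP/(_ i)|]; last by rewrite mulr0.
  by rewrite iV (negbTE mi).
move=> f0 m mf; apply: contrapT => nm; move: mf; rewrite mcoeff_msupp => /eqP; apply.
have mV : [forall i, (i \notin V) ==> (m i == 0%N)].
  apply/forallP => i; apply/implyP => iV; apply/negPn/negP => mi.
  by apply: nm; exists i.
have := congr1 (fun g => g@_m) f0; rewrite /= mcoeff0 => <-.
rewrite [f in RHS]mpolyE !rmorph_sum raddf_sum /= {1}[f]mpolyE raddf_sum /=.
apply: eq_bigr => m' _; rewrite -mul_mpolyC rmorphM /= kill_varsX [kill_vars _%:MP]mmapC.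
case: ifPn => [//|nm']; rewrite mulr0 mcoeff0 mcoeffCM mcoeffX.
case: eqP => [mm'|_]; last by rewrite mulr0.
by rewrite mm' mV in nm'.
Qed.

Lemma prime_var_ideal : prime_ideal var_ideal.
Proof.
rewrite var_idealE; apply: (prime_preimage kill_vars (P := [set (0 : S)])); split.
- by split=> [//|x y -> ->|x y ->]; rewrite /= ?addr0 ?mulr0.
- by move=> /seteqP[_ /(_ 1 I)] /eqP; rewrite oner_eq0.
- by move=> x y /eqP; rewrite mulf_eq0 => /orP[]/eqP->; [left|right].
Qed.

Lemma indep_var_ideal : indep var_ideal V.
Proof.
move=> g gV Vg; apply/mpolyP => m; rewrite mcoeff0; apply: memN_msupp_eq0.
by apply/negP => mg; have [i iV] := gV m mg; rewrite (Vg m mg).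
Qed.

Lemma var_idealX (m : 'X_{1..n}) : var_ideal 'X_[m] <-> exists2 i, i \notin V & m i != 0%N.
Proof.
split=> [|[i iV mi] m']; first by apply; rewrite msuppX inE.
by rewrite msuppX inE => /eqP->; exists i.
Qed.

Lemma prime_height_var_ideal : (prime_height var_ideal <= (Some (n - #|V|)%N : enat))%O.
Proof.
apply: prime_height_le => j /(prime_chain_card prime_var_ideal indep_var_ideal).
by rewrite -ltnS => jV; rewrite leq_subRL; lia.
Qed.

End VariableIdeal.

(** * Dual graphs *)

Section DualGraphs.
Variables (n : nat) (K : fieldType) (ord : rel 'X_{1..n}).
Hypotheses (hord : term_order ord) (hK : enough_places K).
Local Notation S := {mpoly K[n]}.
Implicit Types (f g h : S) (a b m : 'X_{1..n}) (I J P Q : set S) (U V B : {set 'I_n}).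
Variable F : S.
Hypothesis F_lead : initial_monomial ord F (ones n).
Local Notation knutson := (knutson F).
Local Notation inM := (inM ord).
Local Notation ini := (initial_ideal ord).

(** Let [U] be maximal independent modulo a prime [P] over in(J). Leading monomials of [J] lie in
    [P], so [U] is independent modulo [J], hence modulo some component [Q]: otherwise the product of
    one relation per component would be a relation modulo [J]. Then [Q] has height at most n - |U|,
    and [P] at least that. *)
Lemma height_le_initial J : knutson J -> (height J <= height (ini J))%O.
Proof.
move=> kJ; have hJ := knutson_ideal kJ; apply: le_height => P hP JP.
have [U [PU _ Uchain]] := max_indep_chain hP.
apply: le_trans (prime_height_ge Uchain).
have JU : indep J U.
  move=> g Jg Ug; apply: contrapT => /eqP/(lead_exists hord)[a la].
  suff /eqP : 'X_[a] = 0 :> S by rewrite -msupp_eq0 msuppX.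
  apply: PU; first by apply: JP; apply/initial_idealX => //; exists g.
  by apply: polyinX; apply: Ug; case: la.
have [s [sP JE]] := knutson_decomposition hord F_lead hK kJ.
have [Q Qs QU] : exists2 Q, Q \in s & indep Q U.
  apply: contrapT => nex.
  have /choice[x Hx] : forall Q, exists x, Q \in s -> [/\ Q x, polyin U x & x != 0].
    move=> Q; case: (boolP (Q \in s)) => [Qs|_]; last by exists 0.
    apply: contrapT => nx; apply: nex; exists Q => // g Qg Ug.
    by apply: contrapT => /eqP g0; apply: nx; exists g.
  have : \prod_(Q <- s) x Q != 0.
    by rewrite prodf_seq_neq0; apply/allP => Q Qs; have [] := Hx Q Qs.
  case/eqP; apply: JU.
    rewrite JE => Q Qs; rewrite (big_rem Q) //=; apply: idealMr.
      by have [/knutson_ideal] := sP Q Qs.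
    by have [] := Hx Q Qs.
  rewrite big_seq; elim/big_ind: _ => [|y z|Q Qs]; [|exact: polyinM|by have [] := Hx Q Qs].
  by rewrite -mpolyX0; apply: polyinX => i _; rewrite mnm0E.
have [_ pQ] := sP Q Qs.
apply: (le_trans (height_le (J := J) pQ _)); first by rewrite JE => x; apply.
apply: prime_height_le => j /(prime_chain_card pQ QU) jU.
by rewrite leq_subRL; lia.
Qed.

(** By radicality, a monomial of in(I) supported in [V] would put the product of the variables of
    [V] into in(I). *)
Lemma initial_sub_var_ideal I V : knutson I -> ~ inM I (indic V) ->
  ini I `<=` @var_ideal n K V.
Proof.
move=> kI nIV; have hI := knutson_ideal kI; rewrite initial_idealE // => x Ix m /Ix Im.
apply: contrapT => nm; apply: nIV.
apply: (inM_up hord hI (proj1 (inM_indic hord F_lead hK m kI) Im)).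
apply/mnm_lepP => i; rewrite !mnmE inE; case: (boolP (i \in V)) => [_|iV]; first by case: eqP.
by case: eqP => //= /eqP mi; case: nm; exists i.
Qed.

(** A prime over [I] contains a component [Q]. For [U] maximal independent modulo [Q],
    [initial_indep] gives [V] with |V| >= |U| whose [var_ideal], of height at most n - |V|, contains
    in(I). *)
Lemma height_initial_le I : knutson I -> (height (ini I) <= height I)%O.
Proof.
move=> kI; apply: le_height => P hP IP.
have [s [sP IE]] := knutson_decomposition hord F_lead hK kI.
have [||Q Qs QP] := @prime_meet _ _ s P _ hP; first by move=> Q /sP[/knutson_ideal].
  by rewrite -IE.
have [kQ pQ] := sP Q Qs; have hQ := knutson_ideal kQ.
apply: le_trans (prime_heightS hP QP).
have [U [QU _ Uchain]] := max_indep_chain pQ.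
apply: le_trans (prime_height_ge Uchain).
have [a|V [nV UV]] := initial_indep hord hQ _ QU.
  by move=> Qa; apply/(inM_indic hord F_lead hK a kQ).
have IV : ini I `<=` @var_ideal n K V.
  have IQ : I `<=` Q by rewrite IE => x; apply.
  move=> x /(initial_idealS hord (knutson_ideal kI) hQ IQ).
  exact: initial_sub_var_ideal.
apply: le_trans (height_le (@prime_var_ideal n K V) IV) _.
apply: le_trans (@prime_height_var_ideal n K V) _.
by apply: (leq_sub2l n UV).
Qed.

Lemma knutson_meet (s : seq (set S)) : (forall P, P \in s -> knutson P) -> knutson (meet s).
Proof.
elim: s => [|P s IHs] sP.
  by have -> : meet [::] = [set: S] by [apply/seteqP|]; last exact: knutson_setT.
rewrite meet_cons; apply: (knutson_cap hord); first by apply: sP; rewrite mem_head.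
by apply: IHs => Q Qs; apply: sP; rewrite inE Qs orbT.
Qed.

Lemma initial_cap I J : knutson I -> knutson J -> ini (I `&` J) = ini I `&` ini J.
Proof.
move=> kI kJ; have hI := knutson_ideal kI; have hJ := knutson_ideal kJ.
have hIJ := is_ideal_cap hI hJ.
apply/seteqP; split.
  by move=> x xIJ; split; apply: (initial_idealS hord _ _ _ xIJ) => // y [].
move=> x []; rewrite !initial_idealE // => Ix Jx m mx.
by apply: (inM_cap hord F_lead hK kI kJ); [apply: Ix|apply: Jx].
Qed.

Lemma initial_add I J : knutson I -> knutson J ->
  ini (ideal_add I J) `<=` ideal_add (ini I) (ini J).
Proof.
move=> kI kJ; have hI := knutson_ideal kI; have hJ := knutson_ideal kJ.
have hA : is_ideal (ideal_add (ini I) (ini J)).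
  by apply: is_ideal_add; apply: is_ideal_initial.
move=> x; rewrite (initial_idealE hord (is_ideal_add hI hJ)).
move=> xIJ; rewrite [x]mpolyE big_seq; apply: ideal_sum => // m /xIJ mIJ.
rewrite -mul_mpolyC; apply: (idealMl _ hA).
case: (inM_add hord F_lead hK kI kJ mIJ) => h.
  by apply: ideal_addl; [exact: is_ideal_initial|apply/(initial_idealX hord m hI)].
by apply: ideal_addr; [exact: is_ideal_initial|apply/(initial_idealX hord m hJ)].
Qed.

Lemma minimal_prime_mem I P (s : seq (set S)) : (forall Q, Q \in s -> knutson Q /\ prime_ideal Q) ->
  I = meet s -> minimal_prime I P -> P \in s.
Proof.
move=> sP IE [hP IP Pmin].
have [||Q Qs QP] := @prime_meet _ _ s P _ hP; first by move=> Q /sP[/knutson_ideal].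
  by rewrite -IE.
rewrite -(Pmin Q) //; first by case: (sP Q Qs).
by rewrite IE => x; apply.
Qed.

Lemma knutson_minimal_prime I P : knutson I -> minimal_prime I P -> knutson P.
Proof.
move=> kI mP; have [s [sP IE]] := knutson_decomposition hord F_lead hK kI.
by have [] := sP P (minimal_prime_mem sP IE mP).
Qed.

(** Since in(I) is the intersection of the initial ideals of the components, the prime [G] contains
    one of these. *)
Lemma initial_cover I G : knutson I -> prime_ideal G -> ini I `<=` G ->
  exists2 P, minimal_prime I P & ini P `<=` G.
Proof.
move=> kI hG IG; have [s [sP IE]] := knutson_decomposition hord F_lead hK kI.
have sini (r : seq (set S)) : (forall Q, Q \in r -> knutson Q) ->
    meet [seq ini Q | Q <- r] `<=` ini (meet r).
  elim: r => [|P r IHr] rP x xr.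
    have h0 : is_ideal (meet [::] : set S) by apply: is_ideal_meet.
    rewrite (initial_idealE hord h0).
    by move=> m _; exists 'X_[m] => //; apply: leadX.
  have rk Q : Q \in r -> knutson Q by move=> Qr; apply: rP; rewrite inE Qr orbT.
  rewrite meet_cons initial_cap; [|by apply: rP; rewrite mem_head|exact: knutson_meet].
  split; first by apply: xr; rewrite mem_head.
  by apply: IHr => // Q Qr; apply: xr; rewrite inE Qr orbT.
have [||_ /mapP[Q Qs ->] QG] := @prime_meet _ _ [seq ini Q | Q <- s] G _ hG.
- by move=> _ /mapP[Q Qs ->]; apply: is_ideal_initial.
- by move=> x xs; apply: IG; rewrite IE; apply: (sini s _ x xs) => Q /sP[].
(* A component below [Q] with fewest square-free initial monomials is minimal among components,
   hence a minimal prime of [I]. *)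
pose q k := `[< exists P, [/\ P \in s, P `<=` Q & #|squarefree_in ord P| = k] >].
have exq : exists k, q k.
  by exists #|squarefree_in ord Q|; apply/asboolP; exists Q; split.
case: (ex_minnP exq) => k /asboolP[P [Ps PQ Pk]] kmin.
have [kP pP] := sP P Ps; have [kQ _] := sP Q Qs.
exists P; last first.
  by move=> x /(initial_idealS hord (knutson_ideal kP) (knutson_ideal kQ) PQ)/QG.
split=> //; first by rewrite IE => x; apply.
move=> T hT IT TP.
have [||P' P's P'T] := @prime_meet _ _ s T _ hT; first by move=> P' /sP[/knutson_ideal].
  by rewrite -IE.
apply/seteqP; split=> //; apply: contrapT => nPT.
have P'P : P' `<` P by split=> [x /P'T/TP //|PP']; apply: nPT => x /PP'/P'T.
have := squarefree_in_proper hord F_lead hK (proj1 (sP P' P's)) kP P'P.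
rewrite Pk ltnNge kmin //; apply/asboolP; exists P'; split=> // x /P'T/TP; exact: PQ.
Qed.

(** Let [J] be the intersection of the components other than [P]. Some square-free x^A is in in(J)
    but not in in(I); enlarge [A] to a maximal [V] with x^V outside in(I). The [var_ideal] of [V]
    misses x^A, so it contains in(P') for no other minimal prime P', as P' contains [J]. *)
Lemma initial_separate I P : knutson I -> minimal_prime I P -> exists G,
  [/\ minimal_prime (ini I) G, ini P `<=` G &
      forall P', minimal_prime I P' -> ini P' `<=` G -> P' = P].
Proof.
move=> kI mP; have hI := knutson_ideal kI.
have [s [sP IE]] := knutson_decomposition hord F_lead hK kI.
have Ps := minimal_prime_mem sP IE mP; have [kP pP] := sP P Ps.
pose J := meet [seq Q <- s | Q != P].
have kJ : knutson J.
  by apply: knutson_meet => Q; rewrite mem_filter => /andP[_ /sP[]].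
have hJ := knutson_ideal kJ.
have IPJ : I = P `&` J.
  rewrite IE; apply/seteqP; split=> x.
    move=> xs; split=> [|Q]; first exact: xs.
    by rewrite mem_filter => /andP[_ /xs].
  move=> [Px Jx] Q Qs; case: (eqVneq Q P) => [->//|QP].
  by apply: Jx; rewrite mem_filter QP.
have nJP : ~ J `<=` P.
  move=> JP; have [|Q] := @prime_meet _ _ [seq Q <- s | Q != P] P _ pP JP.
    by move=> Q; rewrite mem_filter => /andP[_ /sP[/knutson_ideal]].
  rewrite mem_filter => /andP[/eqP QP Qs] QsubP; apply: QP.
  apply: (minimal_prime_eq mP) => //; first by case: (sP Q Qs).
  by rewrite IE => x; apply.
have [a Ja nIa] : exists2 a, inM J a & ~ inM I a.
  apply: contrapT => nex; apply: nJP.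
  have IJ : I `<=` J by rewrite IPJ => x [].
  suff <- : I = J by case: mP.
  apply: (inM_eq hord hI hJ IJ) => a Ja.
  by apply: contrapT => nIa; apply: nex; exists a.
pose A := msetsupp a.
have JA : inM J (indic A) by apply/(inM_indic hord F_lead hK a kJ).
have nIA : ~ inM I (indic A) by move/(inM_indic hord F_lead hK a kI).
pose q k := `[< exists V, [/\ A \subset V, ~ inM I (indic V) & #|V| = k] >].
have exq : exists k, q k by exists #|A|; apply/asboolP; exists A; split.
have ubq k : q k -> (k <= n)%N.
  by move=> /asboolP[V [_ _ <-]]; rewrite -[X in (_ <= X)%N]card_ord; apply: max_card.
case: (ex_maxnP exq ubq) => k /asboolP[V [AV nIV Vk]] kmax.
have IV := initial_sub_var_ideal kI nIV.
have nVX B : B \subset V -> ~ @var_ideal n K V 'X_[indic B].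
  move=> /fintype.subsetP BV /var_idealX[i iV]; rewrite mnmE.
  by case: (boolP (i \in B)) => // /BV; rewrite (negbTE iV).
have nJV : ~ ini J `<=` @var_ideal n K V.
  by move=> JV; apply: (nVX A AV); apply: JV; apply/(initial_idealX hord _ hJ).
have pV := @prime_var_ideal n K V.
exists (@var_ideal n K V); split.
- split=> // Q pQ IQ QV; apply/seteqP; split=> // x Vx.
  have hQ := prime_is_ideal pQ.
  rewrite [x]mpolyE big_seq; apply: ideal_sum => // m /Vx[i iV mi].
  rewrite -mul_mpolyC; apply: idealMl => //.
  (* By maximality of [V] the monomial x_i x^V is in in(I), hence in [Q]; as x^V is not in [Q], x_i
     is. *)
  have /IQ : ini I 'X_[indic (i |: V)].
    apply/initial_idealX => //; apply: contrapT => nI.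
    have : (#|i |: V| <= k)%N.
      apply: kmax; apply/asboolP; exists (i |: V); split=> //.
      exact: fintype.subset_trans AV (finset.subsetUr _ _).
    by rewrite cardsU1 iV Vk add1n ltnn.
  rewrite (_ : indic (i |: V) = U_(i) + indic V)%MM; last first.
    apply/mnmP => j; rewrite mnmDE !mnmE !inE eq_sym.
    by case: (eqVneq i j) => [<-|]; rewrite /= ?(negbTE iV).
  rewrite mpolyXD => /(primeM pQ)[Qi|/QV/nVX []//].
  have e : (m = (m - U_(i)) + U_(i))%MM by rewrite submK // lep1mP.
  by rewrite e mpolyXD; apply: idealMl.
(* This product lies in in(P) and in in(J), hence in in(I), and x^A is outside the prime of [V]. *)
- move=> x Px; have : @var_ideal n K V (x * 'X_[indic A]).
    apply: IV; rewrite IPJ initial_cap //; split.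
      by apply: (idealMr _ (is_ideal_initial _ _)).
    by apply: (idealMl _ (is_ideal_initial _ _)); apply/(initial_idealX hord _ hJ).
  by case/(primeM pV) => // /nVX.
- move=> P' mP' P'V; apply: contrapT => ne; apply: nJV => x Jx; apply: P'V.
  apply: (initial_idealS hord _ _ _ Jx) => //.
    exact/knutson_ideal/(knutson_minimal_prime kI mP').
  move=> y; apply; rewrite mem_filter (minimal_prime_mem sP IE mP') andbT.
  by apply/eqP.
Qed.

Lemma dual_adj_project I G G' P P' : knutson I -> dual_adj (ini I) G G' ->
  minimal_prime I P -> minimal_prime I P' -> ini P `<=` G -> ini P' `<=` G' ->
  P <> P' -> dual_adj I P P'.
Proof.
move=> kI /asboolP[mG mG' GG' GG'h] mP mP' PG P'G' PP'; apply/asboolP; split=> //.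
have kP := knutson_minimal_prime kI mP; have kP' := knutson_minimal_prime kI mP'.
have hP := knutson_ideal kP; have hP' := knutson_ideal kP'.
have up : (height (ideal_add P P') <= esucc (height I))%O.
  apply: le_trans (height_le_initial (knutson_add hord kP kP')) _.
  apply: (le_trans (y := esucc (height (ini I)))); last first.
    exact/esucc_le/height_initial_le.
  rewrite -GG'h; apply: heightS => x /(initial_add kP kP')[y /PG Gy [z /P'G' Gz <-]].
  by exists y => //; exists z.
(* A prime over P + P' strictly contains [P], because [P] and [P'] are distinct minimal primes. *)
have low : (esucc (height I) <= height (ideal_add P P'))%O.
  apply: le_height => T pT PT.
  have PsubT : P `<=` T by move=> x Px; apply: PT; exact: ideal_addl.
  have PltT : P `<` T.
    split=> // TP; apply: PP'; apply/esym.
    apply: (minimal_prime_eq mP); [by case: mP'|by case: mP'|].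
    by move=> x P'x; apply/TP/PT; exact: ideal_addr.
  have pP : prime_ideal P by case: mP.
  apply: le_trans (prime_height_lt pP pT PltT).
  by apply/esucc_le/height_le => //; case: mP.
by apply: le_anti; rewrite up low.
Qed.

(** Each vertex is replaced by a minimal prime from [initial_cover], and immediate repetitions are
    dropped. These choices are arbitrary; the uniqueness hypothesis at the last vertex makes the
    walk end at [P']. *)
Lemma project_path I (s : seq (set S)) G P P' : knutson I ->
  path (dual_adj (ini I)) G s -> minimal_prime I P -> ini P `<=` G ->
  (forall Q, minimal_prime I Q -> ini Q `<=` last G s -> Q = P') ->
  exists2 s', (size s' <= size s)%N & path (dual_adj I) P s' /\ last P s' = P'.
Proof.
move=> kI; elim: s G P => [|G' s IHs] G P /=.
  by move=> _ mP PG uniqP'; exists [::] => //; split=> //; apply: uniqP'.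
move=> /andP[GG' sG'] mP PG uniqP'.
have [_ mG' _ _] := asboolW GG'; have [pG' IG' _] := mG'.
have [Q mQ QG'] := initial_cover kI pG' IG'.
have [s' s's [ps' ls']] := IHs G' Q sG' mQ QG' uniqP'.
case: (pselect (P = Q)) => [->|PQ]; first by exists s' => //; apply: leqW.
exists (Q :: s') => //=; split=> //; rewrite ps' andbT.
exact: (dual_adj_project kI GG' mP mQ PG QG').
Qed.

Lemma diam_knutson I : knutson I -> (diam I <= diam (ini I))%O.
Proof.
move=> kI; apply: esup_le => _ [P mP [P' mP' <-]].
have [G [mG PG _]] := initial_separate kI mP.
have [G' [mG' _ G'P']] := initial_separate kI mP'.
have : (graph_dist (dual_adj (ini I)) G G' <= diam (ini I))%O.
  by apply: le_esup; exists G => //; exists G'.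
apply: le_trans; case E: (graph_dist (dual_adj (ini I)) G G') => [k|]; last by case: graph_dist.
have : (graph_dist (dual_adj (ini I)) G G' <= (Some k : enat))%O by rewrite E.
case/einf_finite => _ [s [ps _ ls] [<-]] sk.
have [|s' s's [ps' ls']] := project_path (P' := P') kI ps mP PG; first by rewrite ls.
(* The projected walk may revisit vertices, whereas [graph_dist] asks for a simple path. *)
move: s's; case/shortenP: ps' ls' => s'' ps'' us'' sub ls'' s's.
apply: (le_trans (y := Some (size s'') : enat)); first by apply: einf_le; exists s''.
apply: leq_trans sk; apply: leq_trans s's.
by apply: uniq_leq_size => //; case/andP: us''.
Qed.

End DualGraphs.

(** * Application to the family of ideals generated from f *)

Lemma enough_places_rat_or_Fp (K : fieldType) :
  (K = rat :> fieldType \/ exists p : nat, prime p /\ K = 'F_p :> fieldType) ->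
  enough_places K.
Proof. by case=> [->|[p [pp ->]]]; [exact: rat_enough_places|exact: Fp_enough_places]. Qed.

Lemma ideal_gen1 (n : nat) (K : fieldType) (f : {mpoly K[n]}) :
  ideal_gen [set f] = principal f.
Proof.
apply/seteqP; split.
  by apply: smallest_sub; [exact: is_ideal_principal|move=> _ ->; exists 1; rewrite ?mul1r].
by move=> _ [q _ <-]; apply: (idealMl _ (is_ideal_gen _)); apply: sub_gen_smallest.
Qed.

Theorem corollary3p5 (K : fieldType)
    (hK : K = rat :> fieldType \/
          exists p : nat, prime p /\ K = 'F_p :> fieldType)
    (n : nat) (f : {mpoly K[n]})
    (le : rel 'X_{1..n}) (hle : term_order le)
    (m : 'X_{1..n}) (hm : initial_monomial le f m)
    (hsq : squarefree_monomial m)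
    (I : set {mpoly K[n]}) (hI : ideal_family f I) (hproper : I <> setT) :
  (diam I <= diam (initial_ideal le I))%O.
Proof.
(* Square-freeness of [m] keeps this subtraction of exponents from truncating. *)
pose r : {mpoly K[n]} := 'X_[ones n - m].
have F_lead : initial_monomial le (f * r) (ones n).
  have -> : ones n = (m + (ones n - m))%MM.
    apply/mnmP => i; rewrite !(mnmDE, mnmBE) mnmE subnKC //; exact: hsq.
  by apply: leadM => //; exact: leadX.
have kf : knutson (f * r) (ideal_gen [set f]).
  by rewrite ideal_gen1; apply: (knutson_principal hle (r := r)).
apply: (diam_knutson hle (enough_places_rat_or_Fp hK) F_lead).
elim: hI => [//|J J' _ kJ hJ'|J J' _ kJ _ kJ'|J J' _ kJ _ kJ'].
- exact: (knutson_colon hle).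
- exact: (knutson_add hle).
- exact: (knutson_cap hle).
Qed.
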